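(* Let $\alpha\in\mathbb{C}$, $C,D\in\mathbb{C}^{2\times 2}$ and $$A=\begin{bmatrix}\alpha I & C\\ D & -\alpha I\end{bmatrix}\in\mathbb{C}^{4\times 4}.$$ Then $W(A)$ is bi-elliptical if and only if the following two conditions hold: (i) there exists $\theta\in\mathbb{R}$ for which $e^{-i\theta}C-e^{i\theta}D^*$ is a scalar multiple of a unitary matrix while $(e^{-i\theta}C-e^{i\theta}D^* )D$ is not normal; and (ii) for this value of $\theta$, with an appropriate choice of the signs of $\sigma_1(\theta),\sigma_2(\theta)$, $$4\sqrt{\det\left(\operatorname{Im}(e^{-i\theta}A)\right)}\,(\sigma_1(\theta)+\sigma_2(\theta))^2=(s_1(\theta)-s_2(\theta))^2.$$ Here $\pm\sigma_1(\theta),\pm\sigma_2(\theta)$ are the eigenvalues of $e^{-i\theta}A$ (counted with multiplicity), and $s_1(\theta),s_2(\theta)$ are the distinct (non-repeating) eigenvalues of $\operatorname{Im}\left((e^{-i\theta}A)^2\right)$.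
   Context: For a square matrix $X$, $\operatorname{Im}X=(X-X^* )/(2i)$. $I$ is the $2\times2$ identity matrix. The numerical range of $A\in\mathbb{C}^{n\times n}$ is $W(A)=\{\langle Ax,x\rangle: x\in\mathbb{C}^n,\ \|x\|=1\}$. $W(A)$ is called bi-elliptical if it is the convex hull of two (non-degenerate) ellipses with distinct centers, neither of which is contained in the convex hull of the other (so that $W(A)$ is not simply an elliptical disk). Circles count as ellipses. The numbers $\sigma_j(\theta)$ are determined only up to sign; condition (ii) means that there is a choice of signs (equivalently, of $\sigma_1(\theta)$ and $\sigma_2(\theta)$ among the values $\pm\sigma_j(\theta)$) for which the displayed equality holds. The square root of the determinant is the nonnegative one. *)

(* Defs.v *)
From mathcomp Require Export all_boot all_order all_algebra.
From mathcomp Require Export complex.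
From mathcomp Require Export boolp classical_sets reals trigo convex.
Set Implicit Arguments.
Unset Strict Implicit.
Unset Printing Implicit Defensive.

Export Order.TTheory GRing.Theory Num.Theory.

#[global] Open Scope classical_set_scope.
#[global] Open Scope sesquilinear_scope.
#[global] Open Scope ring_scope.

(* The complex numbers are R[i] for R : realType, and M ^t* is the conjugate
   transpose of M. *)

Definition cis (R : realType) (t : R) : R[i] := Complex (cos t) (sin t).

Definition im_mx (R : realType) (n : nat) (X : 'M[R[i]]_n) : 'M[R[i]]_n :=
  (2 * 'i)^-1 *: (X - X ^t*).

Definition numerical_range (R : realType) (n : nat) (A : 'M[R[i]]_n) :
    set R[i] :=
  [set z | exists2 x : 'cV[R[i]]_n,
     (x ^t* *m x) 0 0 = 1 & z = (x ^t* *m (A *m x)) 0 0].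

Definition scalar_multiple_of_unitary (R : realType) (n : nat)
    (X : 'M[R[i]]_n) : Prop :=
  exists (c : R[i]) (U : 'M[R[i]]_n), U \is unitarymx /\ X = c *: U.

(* Convexity is with respect to real coefficients: Rcomplex R is R[i] seen as
   a vector space over R. *)
Definition convex_hull (R : realType) (S : set R[i]) : set R[i] :=
  smallest (@convex_set R (Rcomplex R)) S.

(* The ellipse (a curve) with foci f1 and f2 and major axis of length 2a. The
   strict inequality excludes segments, points and the empty set; f1 = f2 gives
   the circles of positive radius. *)
Definition is_ellipse (R : realType) (E : set R[i]) (center : R[i]) : Prop :=
  exists (f1 f2 : R[i]) (a : R),
    [/\ `|f1 - f2| < (2 * a)%:C%C,
        E = [set z : R[i] | `|z - f1| + `|z - f2| = (2 * a)%:C%C]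
      & center = (f1 + f2) / 2].

Definition bi_elliptical (R : realType) (W : set R[i]) : Prop :=
  exists (E1 E2 : set R[i]) (c1 c2 : R[i]),
    [/\ is_ellipse E1 c1, is_ellipse E2 c2 & c1 <> c2] /\
    [/\ ~ E1 `<=` convex_hull E2, ~ E2 `<=` convex_hull E1
      & W = convex_hull (E1 `|` E2)].

(* Main.v *)
Require Import Defs.
From mathcomp Require Import interval_inference ring lra.
Set Implicit Arguments.
Unset Strict Implicit.
Unset Printing Implicit Defensive.

(** Write [C = L + iG], [D^* = L - iG] and [alpha = a + ib]. For a direction
    [(s, t)] the matrix [s Re A + t Im A] is [[k, N], [N^*, -k]] with
    [k = s a + t b] and [N = s L + t G], and its square has the diagonal blocks
    [k^2 + N N^*] and [k^2 + N^* N]. Hence the support function of the numerical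
    range is [sqrt (p + |u|)], where [p] and the vector [u] are the Pauli
    coordinates of [M = k^2 + N N^* = s^2 P1 + 2 s t P2 + t^2 P3].

    An ellipse centered at [c] has support function [l + sqrt g] with [l] linear
    and [g] a positive definite quadratic form. If the range is bi-elliptical,
    then after a rotation [l = r s] with [r > 0], and [l + sqrt g] is the
    support function on an arc of directions. There
    [((l + sqrt g)^2 - p)^2 = |u|^2]; as [sqrt g] is not rational, this forces
    [p = l^2 + g] and [|u|^2 = 4 l^2 g] as forms in [(s, t)]. Conversely these
    identities turn the support function into [|l| + sqrt g], that of the union
    of two translates of one ellipse, and the range is the convex hull of that
    union by the Toeplitz-Hausdorff theorem.

    Comparing coefficients: [u] vanishes at [(0, 1)], i.e. [P3], equivalently
    [G G^*], is scalar; [P1] and [P2] do not commute, which means that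
    [(C - D^* ) D] is not normal; and the remaining two real equations are the
    real and imaginary parts of condition (ii), since
    [alpha^2 + C D = P1 - P3 + 2 i P2] and [Im (A^2)] has the eigenvalues of
    [2 P2]. *)

(** * Convex hulls and ellipses *)

Definition cvx (R : realType) (K : set R[i]) : Prop :=
  forall (x y : R[i]) (k : R), 0 <= k <= 1 -> K x -> K y ->
    K (k%:C%C * x + (1 - k)%:C%C * y).

Lemma convex_setE (R : realType) (K : set R[i]) :
  @convex_set R (Rcomplex R) K <-> cvx K.
Proof.
have sc (k : R) (x : Rcomplex R) : k *: x = k%:C%C * (x : R[i]).
  by case: x => a b; rewrite /= /GRing.mul /= !mul0r subr0 addr0.
split=> [cK x y k /andP[k0 k1] Kx Ky|cK x y l].
  have := cK x y (Itv01 k0 k1); rewrite !inE => /(_ Kx Ky).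
  by rewrite /conv /= -!sc.
rewrite !inE => Kx Ky; rewrite /conv /= !sc; apply: cK => //.
by rewrite ge0 le1.
Qed.

Lemma sub_convex_hull (R : realType) (S : set R[i]) : S `<=` convex_hull S.
Proof. by move=> z Sz K [_ /(_ z Sz)]. Qed.

Lemma convex_hull_min (R : realType) (S K : set R[i]) :
  cvx K -> S `<=` K -> convex_hull S `<=` K.
Proof. by move=> cK SK z /(_ K); apply; split=> //; apply/convex_setE. Qed.

Lemma convex_hull_cvx (R : realType) (S : set R[i]) : cvx (convex_hull S).
Proof.
move=> x y k k01 hx hy K [cK SK].
by apply: (proj1 (convex_setE K) cK) => //; [apply: hx|apply: hy].
Qed.

Lemma subset_convex_hull (R : realType) (S T : set R[i]) :
  S `<=` T -> convex_hull S `<=` convex_hull T.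
Proof.
move=> ST; apply: convex_hull_min; first exact: convex_hull_cvx.
by move=> z /ST; exact: sub_convex_hull.
Qed.

Definition qform (R : realType) (a b c x y : R) : R :=
  a * x ^+ 2 + 2 * b * (x * y) + c * y ^+ 2.

Definition dir (R : realType) (s t : R) (z : R[i]) : R :=
  s * complex.Re z + t * complex.Im z.

(* The ellipse centered at c whose support function, relative to c, is the
   square root of qform a b d. *)
Definition ell (R : realType) (a b d : R) (c : R[i]) : set R[i] :=
  [set z | qform d (- b) a (complex.Re (z - c)) (complex.Im (z - c))
           = a * d - b ^+ 2].

Definition posdef (R : realType) (a b d : R) : Prop :=
  [/\ 0 < a, 0 < d & b ^+ 2 < a * d].

Lemma qform_gt0 (R : realType) (a b d x y : R) :
  posdef a b d -> (x != 0) || (y != 0) -> 0 < qform a b d x y.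
Proof.
move=> [a0 d0 det0] xy; rewrite /qform.
rewrite -(pmulr_rgt0 _ a0).
have -> : a * (a * x ^+ 2 + 2 * b * (x * y) + d * y ^+ 2) =
  (a * x + b * y) ^+ 2 + (a * d - b ^+ 2) * y ^+ 2 by ring.
have h : 0 < a * d - b ^+ 2 by rewrite subr_gt0.
have [y0|y0] := eqVneq y 0.
  move: xy; rewrite y0 eqxx orbF => x0.
  rewrite mulr0 addr0 expr0n /= mulr0 addr0 exprn_even_gt0 //=.
  by rewrite mulf_neq0 // gt_eqF.
by rewrite ltr_wpDl ?sqr_ge0 // mulr_gt0 // exprn_even_gt0.
Qed.

Lemma qform_ge0 (R : realType) (a b d x y : R) :
  posdef a b d -> 0 <= qform a b d x y.
Proof.
move=> pd; have [/negP xy|/negPn] := boolP (~~ ((x != 0) || (y != 0))).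
  have : (x == 0) && (y == 0) by move/negP: xy; rewrite negb_or !negbK.
  by move=> /andP[/eqP -> /eqP ->]; rewrite /qform; lra.
by move=> /(qform_gt0 pd) /ltW.
Qed.

Lemma posdef_dual (R : realType) (a b d : R) :
  posdef a b d -> posdef d (- b) a.
Proof. by move=> [a0 d0 ad]; split=> //; rewrite sqrrN mulrC. Qed.

Lemma cvx_halfplane (R : realType) (s t k : R) :
  cvx [set z : R[i] | dir s t z <= k].
Proof.
move=> [x1 x2] [y1 y2] l /andP[l0 l1]; rewrite /dir /= => hx hy.
have -> : s * (l * x1 - 0 * x2 + ((1 - l) * y1 - 0 * y2)) +
  t * (l * x2 + 0 * x1 + ((1 - l) * y2 + 0 * y1)) =
  l * (s * x1 + t * x2) + (1 - l) * (s * y1 + t * y2) by ring.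
have : l * (s * x1 + t * x2) <= l * k by rewrite ler_wpM2l.
have : (1 - l) * (s * y1 + t * y2) <= (1 - l) * k.
  by rewrite ler_wpM2l // subr_ge0.
lra.
Qed.

Lemma dirB (R : realType) (s t : R) (z w : R[i]) :
  dir s t (z - w) = dir s t z - dir s t w.
Proof. by case: z w => [a b] [c d]; rewrite /dir /=; ring. Qed.

(** Cauchy-Schwarz for a form and its dual: on the ellipse the determinant times
    [qform a b d s t - (s * x + t * y) ^+ 2] is a perfect square. *)
Lemma ell_dir_le (R : realType) (a b d : R) (c z : R[i]) (s t : R) :
  posdef a b d -> ell a b d c z ->
  dir s t z <= dir s t c + Num.sqrt (qform a b d s t).
Proof.
move=> pd; rewrite /ell /=; rewrite -lerBlDl -dirB /dir.
set x := complex.Re _; set y := complex.Im _ => e.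
have [a0 d0 ad] := pd.
apply: (le_trans (ler_norm _)); rewrite -sqrtr_sqr ler_sqrt ?qform_ge0 //.
have : (a * d - b ^+ 2) * (qform a b d s t - (s * x + t * y) ^+ 2) =
   ((a * s + b * t) * y - (b * s + d * t) * x) ^+ 2
  by rewrite mulrBr -{1}e /qform; ring.
move=> h; rewrite -subr_ge0 -(@pmulr_rge0 _ (a * d - b ^+ 2)) ?h ?sqr_ge0 //.
by rewrite subr_gt0.
Qed.

Lemma ell_dir_attained (R : realType) (a b d : R) (c : R[i]) (s t : R) :
  posdef a b d -> (s != 0) || (t != 0) ->
  exists2 z, ell a b d c z
    & dir s t z = dir s t c + Num.sqrt (qform a b d s t).
Proof.
move=> pd st; have g0 := qform_gt0 pd st.
set q := Num.sqrt _; have q0 : q != 0 by rewrite gt_eqF // sqrtr_gt0.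
have qq : q ^+ 2 = qform a b d s t by rewrite sqr_sqrtr // ltW.
(* The contact point: the matrix of the form applied to the direction, normalised by [q]. *)
exists (c + Complex ((a * s + b * t) / q) ((b * s + d * t) / q)).
  rewrite /ell /= addrC addKr /=.
  have -> : qform d (- b) a ((a * s + b * t) / q) ((b * s + d * t) / q) =
    (a * d - b ^+ 2) * qform a b d s t / q ^+ 2 by rewrite /qform; field.
  by rewrite qq mulfK // gt_eqF.
case: c => [c1 c2]; rewrite /dir /=.
have -> : s * (c1 + (a * s + b * t) / q) + t * (c2 + (b * s + d * t) / q) =
  s * c1 + t * c2 + qform a b d s t / q by rewrite /qform; field.
by rewrite -qq expr2 mulfK.
Qed.

(** A point of the filled ellipse lies on the chord through it and the centre, between two antipodal
    endpoints. *)
Lemma ell_disk_hull (R : realType) (a b d : R) (c z : R[i]) :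
  posdef a b d ->
  qform d (- b) a (complex.Re (z - c)) (complex.Im (z - c)) <= a * d - b ^+ 2 ->
  convex_hull (ell a b d c) z.
Proof.
move=> pd; have [a0 d0 ad] := pd; set det := a * d - b ^+ 2.
have det0 : 0 < det by rewrite subr_gt0.
case: c z => [c1 c2] [z1 z2] /=; set x := z1 - c1; set y := z2 - c2 => le.
(* The centre determines no chord; it is the midpoint of the two points offset by plus and minus
   [(Num.sqrt a, b / Num.sqrt a)]. *)
have [xy|] := boolP ((x != 0) || (y != 0)); last first.
  rewrite negb_or !negbK => /andP[/eqP x0 /eqP y0].
  have e1 : ell a b d (Complex c1 c2) (Complex (c1 + Num.sqrt a) (c2
    + b / Num.sqrt a)).
    have q0 : Num.sqrt a != 0 by rewrite gt_eqF // sqrtr_gt0.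
    have h (q : R) : q != 0 -> qform d (- b) (q ^+ 2) (c1 + q - c1)
        (c2 + b / q - c2) = q ^+ 2 * d - b ^+ 2.
      by move=> qn0; rewrite /qform; field.
    by move: (h _ q0); rewrite sqr_sqrtr // ltW.
  have e2 : ell a b d (Complex c1 c2) (Complex (c1 - Num.sqrt a) (c2
    - b / Num.sqrt a)).
    rewrite /ell /= in e1 *; rewrite -e1 /qform; ring.
  have := @convex_hull_cvx R (ell a b d (Complex c1 c2)) _ _ (2^-1) _
     (sub_convex_hull e1) (sub_convex_hull e2).
  set w := (X in convex_hull _ X).
  have -> : w = Complex z1 z2.
    have -> : z1 = c1 by move: x0; rewrite /x; lra.
    have -> : z2 = c2 by move: y0; rewrite /y; lra.
    rewrite /w; apply/eqP; rewrite eq_complex /=.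
    by apply/andP; split; apply/eqP; field; rewrite gt_eqF // sqrtr_gt0.
  by apply; lra.
have n0 : 0 < qform d (- b) a x y by apply: qform_gt0 => //; exact: posdef_dual.
set n := qform _ _ _ _ _ in le n0.
(* [m] stretches the point to the ellipse; the weight [(1 + m^-1) / 2] and its complement average
   the factors [m] and [- m] to 1. *)
pose m := Num.sqrt (det / n).
have m2 : m ^+ 2 = det / n by rewrite sqr_sqrtr // divr_ge0 // ltW.
have m1 : 1 <= m.
  rewrite -[leLHS]sqrtr1 /m ler_sqrt ?divr_ge0 ?(ltW det0) ?(ltW n0) //.
  by rewrite ler_pdivlMr // mul1r.
have e (k : R) : k ^+ 2 = m ^+ 2 ->
    ell a b d (Complex c1 c2) (Complex (c1 + k * x) (c2 + k * y)).
  move=> km; rewrite /ell /=.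
  have -> : qform d (- b) a (c1 + k * x - c1) (c2 + k * y - c2) = k ^+ 2 * n.
    by rewrite /n /qform; ring.
  by rewrite km m2 divfK // gt_eqF.
have m0 : 0 < m by apply: lt_le_trans m1.
have := @convex_hull_cvx R (ell a b d (Complex c1 c2)) _ _ ((1 + m^-1) / 2) _
   (sub_convex_hull (e m erefl)) (sub_convex_hull (e (- m) (sqrrN m))).
set w := (X in convex_hull _ X).
have -> : w = Complex z1 z2.
  rewrite /w; apply/eqP; rewrite eq_complex /= /x /y.
  by apply/andP; split; apply/eqP; field; rewrite gt_eqF.
apply; have : 0 < m^-1 by rewrite invr_gt0.
have : m^-1 <= 1 by rewrite invf_le1.
lra.
Qed.

(** The squared focal distances differ by [4 * u]. If the distances sum to [2 * a], then
    [a * d2 = a ^+ 2 + u], and squaring gives the conic. Conversely the conic makes the distances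
    equal to [a + u / a] and [a - u / a] up to sign, and [|u| <= a ^+ 2] settles the signs. *)
Lemma focal_equation (R : realType) (a p q x y : R) :
  0 < a -> p ^+ 2 + q ^+ 2 < a ^+ 2 ->
  Num.sqrt ((x - p) ^+ 2 + (y - q) ^+ 2)
    + Num.sqrt ((x + p) ^+ 2 + (y + q) ^+ 2) = 2 * a <->
  qform (a ^+ 2 - p ^+ 2) (- (p * q)) (a ^+ 2 - q ^+ 2) x y
    = (a ^+ 2 - q ^+ 2) * (a ^+ 2 - p ^+ 2) - (p * q) ^+ 2.
Proof.
move=> a0 fa.
set d1 := Num.sqrt _; set d2 := Num.sqrt _.
have d1E : d1 ^+ 2 = (x - p) ^+ 2 + (y - q) ^+ 2.
  by rewrite sqr_sqrtr // addr_ge0 ?sqr_ge0.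
have d2E : d2 ^+ 2 = (x + p) ^+ 2 + (y + q) ^+ 2.
  by rewrite sqr_sqrtr // addr_ge0 ?sqr_ge0.
have an0 : a != 0 by rewrite gt_eqF.
pose u := p * x + q * y.
split=> [e|].
  have d1' : d1 = 2 * a - d2 by rewrite -e addrK.
  have e2 : a * d2 = a ^+ 2 + u.
    apply: (@mulfI _ 4); first by rewrite pnatr_eq0.
    by move: d1E d2E; rewrite d1' /u; lra.
  have : a ^+ 2 * ((x + p) ^+ 2 + (y + q) ^+ 2) = (a ^+ 2 + u) ^+ 2.
    by rewrite -d2E -e2; ring.
  rewrite /u /qform; move=> h; apply/eqP; rewrite -subr_eq0.
  move/eqP: h; rewrite -subr_eq0 => /eqP h; apply/eqP; rewrite -h; ring.
move=> e.
have e1 : a ^+ 2 * (x ^+ 2 + y ^+ 2) = u ^+ 2 + a ^+ 2 * (a ^+ 2 - p ^+ 2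
  - q ^+ 2).
  move/eqP: e; rewrite -subr_eq0 => /eqP e.
  by apply/eqP; rewrite -subr_eq0 -e /u /qform; apply/eqP; ring.
have cs : u ^+ 2 <= (p ^+ 2 + q ^+ 2) * (x ^+ 2 + y ^+ 2).
  rewrite -subr_ge0; have -> : (p ^+ 2 + q ^+ 2) * (x ^+ 2 + y ^+ 2) - u ^+ 2 =
    (p * y - q * x) ^+ 2 by rewrite /u; ring.
  exact: sqr_ge0.
(* Cauchy-Schwarz bounds [u] by the norm of the point, which [e1] expresses through [u]; solving for
   [u] uses [p ^+ 2 + q ^+ 2 < a ^+ 2]. *)
have ua : u ^+ 2 <= (a ^+ 2) ^+ 2.
  have h1 : a ^+ 2 * u ^+ 2 <= (p ^+ 2 + q ^+ 2) * (u ^+ 2 + a ^+ 2 * (a ^+ 2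
    - p ^+ 2 - q ^+ 2)).
    by rewrite -e1 [leRHS]mulrCA ler_pM2l ?exprn_gt0.
  have h2 : (a ^+ 2 - p ^+ 2 - q ^+ 2) * (u ^+ 2) <= (a ^+ 2 - p ^+ 2
    - q ^+ 2) * (a ^+ 2 * (p ^+ 2 + q ^+ 2)).
    move: h1; lra.
  have k0 : 0 < a ^+ 2 - p ^+ 2 - q ^+ 2 by lra.
  rewrite ler_pM2l // in h2; apply: (le_trans h2).
  rewrite (expr2 (a ^+ 2)) ler_pM2l; [exact: ltW|exact: exprn_gt0].
have ua' : `|u| <= a ^+ 2.
  by rewrite -(ger0_norm (sqr_ge0 a)) -ler_sqr ?nnegrE ?normr_ge0 //
    !real_normK ?num_real // ger0_norm ?sqr_ge0.
have [u1 u2] : - a ^+ 2 <= u /\ u <= a ^+ 2 by apply/andP; rewrite -ler_norml.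
have e2 : d2 = a + u / a.
  have pos : 0 <= a + u / a.
    have -> : a + u / a = (a ^+ 2 + u) / a by field.
    by rewrite divr_ge0 ?(ltW a0) //; lra.
  apply/eqP; rewrite -(@eqrXn2 _ 2) ?sqrtr_ge0 //.
  apply/eqP/(@mulfI _ (a ^+ 2)); first by rewrite expf_neq0.
  have -> : a ^+ 2 * (a + u / a) ^+ 2 = (a ^+ 2 + u) ^+ 2 by field.
  rewrite d2E.
  have -> : a ^+ 2 * ((x + p) ^+ 2 + (y + q) ^+ 2) =
    a ^+ 2 * (x ^+ 2 + y ^+ 2) + 2 * a ^+ 2 * u + a ^+ 2 * (p ^+ 2 + q ^+ 2)
      by rewrite /u; ring.
  by rewrite e1; ring.
have e3 : d1 = a - u / a.
  have pos : 0 <= a - u / a.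
    have -> : a - u / a = (a ^+ 2 - u) / a by field.
    by rewrite divr_ge0 ?(ltW a0) //; lra.
  apply/eqP; rewrite -(@eqrXn2 _ 2) ?sqrtr_ge0 //.
  apply/eqP/(@mulfI _ (a ^+ 2)); first by rewrite expf_neq0.
  have -> : a ^+ 2 * (a - u / a) ^+ 2 = (a ^+ 2 - u) ^+ 2 by field.
  rewrite d1E.
  have -> : a ^+ 2 * ((x - p) ^+ 2 + (y - q) ^+ 2) =
    a ^+ 2 * (x ^+ 2 + y ^+ 2) - 2 * a ^+ 2 * u + a ^+ 2 * (p ^+ 2 + q ^+ 2)
      by rewrite /u; ring.
  by rewrite e1; ring.
by rewrite e2 e3; ring.
Qed.

Lemma focal_ell (R : realType) (f1 f2 : R[i]) (a : R) :
  let f := (f1 - f2) / 2 in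
  let p := complex.Re f in let q := complex.Im f in
  0 < a -> p ^+ 2 + q ^+ 2 < a ^+ 2 ->
  [set z : R[i] | `|z - f1| + `|z - f2| = (2 * a)%:C%C] =
  ell (a ^+ 2 - q ^+ 2) (p * q) (a ^+ 2 - p ^+ 2) ((f1 + f2) / 2).
Proof.
move=> f p q a0 fa; apply/seteqP.
have e1 z : z - f1 = (z - (f1 + f2) / 2) - f by rewrite /f; field.
have e2 z : z - f2 = (z - (f1 + f2) / 2) + f by rewrite /f; field.
have h z : (`|z - f1| + `|z - f2| = (2 * a)%:C%C) <->
  Num.sqrt ((complex.Re (z - (f1 + f2) / 2) - p) ^+ 2 + (complex.Im (z - (f1
    + f2) / 2) - q) ^+ 2)
    + Num.sqrt ((complex.Re (z - (f1 + f2) / 2) + p) ^+ 2 + (complex.Im (z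
      - (f1 + f2) / 2) + q) ^+ 2) = 2 * a.
  rewrite e1 e2 !normc_def /p /q.
  case: (z - _) => x y; case: (f) => u v /=.
  by rewrite -rmorphD; split=> [/complexI|->].
split=> z /=; rewrite /ell /=.
  by move=> /h /(focal_equation _ _ a0 fa).
by move=> /(focal_equation _ _ a0 fa) /h.
Qed.

(** From foci to form this is [focal_ell]. Conversely, if [p + iq] is half the focal vector, then
    [a - d = p ^+ 2 - q ^+ 2] and [b = p * q], so a complex square root of [a - d + 2ib] recovers
    the foci. *)
Lemma is_ellipse_ell (R : realType) (E : set R[i]) (c : R[i]) :
  is_ellipse E c <-> exists a b d, posdef a b d /\ E = ell a b d c.
Proof.
split.
  move=> [f1 [f2 [a [lt -> ->]]]].
  move: (@focal_ell R f1 f2 a) => /=; set f := (f1 - f2) / 2.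
  set p := complex.Re f; set q := complex.Im f => main.
  have lt2 : Num.sqrt (p ^+ 2 + q ^+ 2) < a.
    move: lt; have -> : f1 - f2 = 2 * f by rewrite /f; field.
    rewrite normrM normr_nat normc_def -/p -/q.
    have -> : (2 : R[i]) = (2 : R)%:C%C by rewrite rmorph_nat.
    by rewrite -rmorphM ltcR ltr_pM2l.
  have a0 : 0 < a by apply: le_lt_trans lt2; exact: sqrtr_ge0.
  have fa : p ^+ 2 + q ^+ 2 < a ^+ 2.
    rewrite -(@sqr_sqrtr _ (p ^+ 2 + q ^+ 2)) ?addr_ge0 ?sqr_ge0 //.
    by rewrite ltr_pXn2r ?nnegrE ?sqrtr_ge0 // ltW.
  exists (a ^+ 2 - q ^+ 2), (p * q), (a ^+ 2 - p ^+ 2).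
  split; last exact: main.
  have p0 := sqr_ge0 p; have q0 := sqr_ge0 q.
  split; [lra|lra|].
  rewrite -subr_gt0.
  have -> : (a ^+ 2 - q ^+ 2) * (a ^+ 2 - p ^+ 2) - (p * q) ^+ 2 =
    a ^+ 2 * (a ^+ 2 - (p ^+ 2 + q ^+ 2)) by ring.
  by rewrite mulr_gt0 ?exprn_gt0 // subr_gt0.
move=> [a [b [d [pd ->]]]].
have [a0 d0 ad] := pd.
case ef : (sqrtc (Complex (a - d) (2 * b))) => [p q].
have := sqr_sqrtc (Complex (a - d) (2 * b)); rewrite ef => /eqP.
rewrite expr2 eq_complex /= => /andP[/eqP e1 /eqP e2].
have q0 := sqr_ge0 q.
pose A := Num.sqrt (a + q ^+ 2).
have A2 : A ^+ 2 = a + q ^+ 2 by rewrite sqr_sqrtr // addr_ge0 // ltW.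
have A0 : 0 < A by rewrite sqrtr_gt0 ltr_wpDr.
have e3 : d = A ^+ 2 - p ^+ 2 by rewrite A2; lra.
have e4 : a = A ^+ 2 - q ^+ 2 by rewrite A2; ring.
have e5 : b = p * q by lra.
have fa : p ^+ 2 + q ^+ 2 < A ^+ 2.
  rewrite -subr_gt0 -(@pmulr_rgt0 _ (A ^+ 2)) ?exprn_gt0 //.
  move: ad; rewrite -subr_gt0 {1}e3 {1}e4 e5.
  by congr (0 < _); ring.
exists (c + Complex p q), (c - Complex p q), A.
have ef2 : (c + Complex p q - (c - Complex p q)) = 2 * Complex p q by ring.
have ef3 : (c + Complex p q - (c - Complex p q)) / 2 = Complex p q by field.
have ec : (c + Complex p q + (c - Complex p q)) / 2 = c by field.
split; last by rewrite ec.
  rewrite ef2 normrM normr_nat normc_def /=.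
  have -> : (2 : R[i]) = (2 : R)%:C%C by rewrite rmorph_nat.
  rewrite -rmorphM ltcR ltr_pM2l // -[ltRHS](ger0_norm (ltW A0)) -sqrtr_sqr.
  by rewrite ltr_sqrt // exprn_gt0.
by rewrite focal_ell ?ef3 //= ec -e3 -e4 -e5.
Qed.

(* The minimiser over [-1, 1] of s |-> qform d (- b) a (x - s * r) y witnesses
   membership in the convex hull of two translates of an ellipse. *)
Lemma stadium_mem (R : realType) (a b d r x y : R) :
  posdef a b d -> 0 < r ->
  (forall s t, s * x + t * y <= r * `|s| + Num.sqrt (qform a b d s t)) ->
  exists2 k : R, - 1 <= k <= 1
    & qform d (- b) a (x - k * r) y <= a * d - b ^+ 2.
Proof.
move=> pd r0 sup; have [a0 d0 ad] := pd.
have rn0 : r != 0 by rewrite gt_eqF.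
have dn0 : d != 0 by rewrite gt_eqF.
(* [k0] is the unconstrained minimiser and [k] its truncation to [-1, 1]; [k * (k0 - k) = |k0 - k|]
   is the optimality condition. *)
pose k0 := (x - b * y / d) / r.
have [k [k1 k2]] : exists k : R,
    - 1 <= k <= 1 /\ k * (k0 - k) = `|k0 - k|.
  have [h|h] := lerP k0 1; last first.
    by exists 1; rewrite mul1r ger0_norm ?subr_ge0 ?(ltW h) //; split => //;
      lra.
  have [h'|h'] := lerP (- 1) k0.
    by exists k0; rewrite subrr mulr0 normr0 h h'.
  exists (- 1); rewrite mulN1r ler0_norm ?subr_le0 ?(ltW h') //; split => //;
    lra.
exists k => //.
set z := x - k * r; set det := a * d - b ^+ 2.
have det0 : 0 < det by rewrite subr_gt0.
set n := qform d (- b) a z y.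
have n0 : 0 <= n by apply/qform_ge0/posdef_dual.
(* Testing the support bound in the normal direction at [(z, y)] yields [n <= Num.sqrt (det * n)],
   hence [n <= det]. *)
pose s := d * z - b * y; pose t := a * y - b * z.
have sE : s = d * r * (k0 - k).
  by rewrite /s /z /k0; field; rewrite rn0 dn0.
have dr0 : 0 < d * r by rewrite mulr_gt0.
have := sup s t.
have -> : qform a b d s t = det * n by rewrite /n /s /t /qform /det; ring.
have -> : s * x + t * y = n + r * (s * k).
  by rewrite /n /s /t /qform /z; ring.
have -> : s * k = `|s|.
  by rewrite sE normrM (gtr0_norm dr0) -k2; ring.
rewrite addrC lerD2l => le.
have [->|nn0] := eqVneq n 0; first exact: ltW.
have np : 0 < n by rewrite lt0r nn0.
rewrite -(ler_pM2r np) -[leRHS](sqr_sqrtr (_ : 0 <= det * n)).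
  by rewrite expr2 ler_pM.
by rewrite mulr_ge0 // ltW.
Qed.

Lemma qform_definite (R : realType) (a b d x y : R) :
  posdef a b d -> qform a b d x y <= 0 -> x = 0 /\ y = 0.
Proof.
move=> pd; have [|] := boolP ((x != 0) || (y != 0)).
  by move/(qform_gt0 pd); rewrite leNgt => ->.
by rewrite negb_or !negbK => /andP[/eqP -> /eqP ->].
Qed.

(** One inclusion is [stadium_mem]. For the other, a contact point with [s != 0] is unique, which
    puts the outer arcs of both ellipses in [W]. For [s = 0] the support line meets the hull in a
    segment, so its endpoints, the four corners, come from a separate hypothesis. The inner arcs
    follow by convexity. *)
Lemma stadium_eq (R : realType) (a b d r : R) (W : set R[i]) :
  posdef a b d -> 0 < r -> cvx W ->
  (forall z s t, W z ->
     dir s t z <= r * `|s| + Num.sqrt (qform a b d s t)) ->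
  (forall s t, s != 0 -> exists2 z, W z &
     dir s t z = r * `|s| + Num.sqrt (qform a b d s t)) ->
  (forall e f : R, e ^+ 2 = 1 -> f ^+ 2 = 1 ->
     W (Complex (e * r + f * b / Num.sqrt d) (f * Num.sqrt d))) ->
  W = convex_hull (ell a b d (r%:C%C) `|` ell a b d (- r%:C%C)).
Proof.
move=> pd r0 cW W_le W_att W_end; have [a0 d0 ad] := pd.
set det := a * d - b ^+ 2 in pd *.
have det0 : 0 < det by rewrite subr_gt0.
have dn0 : d != 0 by rewrite gt_eqF.
have pd' := posdef_dual pd.
apply/seteqP; split=> [[x y] Wz|].
  have [k k1 le] : exists2 k : R, - 1 <= k <= 1
      & qform d (- b) a (x - k * r) y <= a * d - b ^+ 2.
    by apply: stadium_mem => // s t; have := W_le _ s t Wz.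
  have := @convex_hull_cvx R (ell a b d r%:C%C `|` ell a b d (- r%:C%C))
    (Complex (x - k * r + r) y) (Complex (x - k * r - r) y) ((1 + k) / 2).
  set w := (X in _ -> _ -> _ -> convex_hull _ X).
  have -> : w = Complex x y.
    rewrite /w; apply/eqP; rewrite eq_complex /=.
    by apply/andP; split; apply/eqP; field.
  apply.
  - by lra.
  - apply: (@subset_convex_hull R (ell a b d r%:C%C)); first by move=> ? ?;
    left.
    by apply: ell_disk_hull => //=; rewrite addrK subr0.
  - apply: (@subset_convex_hull R (ell a b d (- r%:C%C))); first by move=> ? ?;
    right.
    by apply: ell_disk_hull => //=; rewrite opprK subrK oppr0 subr0.
have outer (e x y : R) : e ^+ 2 = 1 -> qform d (- b) a x y = det ->
    0 <= e * (d * x - b * y) -> W (Complex (e * r + x) y).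
  move=> e2 n1; set s := d * x - b * y; pose t := a * y - b * x => es.
  have esn : `|s| = e * s.
    move/eqP: e2 es; rewrite sqrf_eq1 => /orP[] /eqP ->.
      by rewrite mul1r => /ger0_norm.
    by rewrite mulN1r oppr_ge0 => /ler0_norm.
  (* Here the tangent is horizontal, and the point is one of the corners of [W_end]. *)
  have [s0|sn0] := eqVneq s 0.
    have y2 : y ^+ 2 = d.
      apply: (@mulfI _ det); first by rewrite gt_eqF.
      have -> : det * y ^+ 2 = d * qform d (- b) a x y - s ^+ 2.
        by rewrite /det /s /qform; ring.
      by rewrite n1 s0; ring.
    have q0 : Num.sqrt d != 0 by rewrite gt_eqF // sqrtr_gt0.
    have qd : Num.sqrt d ^+ 2 = d by rewrite sqr_sqrtr // ltW.
    have := W_end e (y / Num.sqrt d) e2; rewrite expr_div_n y2 qd divff //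
      => /(_ erefl).
    rewrite divfK //.
    have -> : y / Num.sqrt d * b / Num.sqrt d = b * y / Num.sqrt d ^+ 2
      by field.
    have -> // : b * y / Num.sqrt d ^+ 2 = x.
    rewrite qd; apply: (@mulfI _ d) => //; move/eqP: s0;
      rewrite subr_eq0 => /eqP ->.
    by field.
  have [z Wz] := W_att s t sn0.
  have -> : qform a b d s t = det ^+ 2.
    rewrite expr2 -{2}n1 /s /t /qform /det; ring.
  rewrite sqrtr_sqr (gtr0_norm det0) esn.
  case: z Wz => z1 z2 Wz; rewrite /dir /= => hz.
  have [k k1 le] : exists2 k : R, - 1 <= k <= 1
      & qform d (- b) a (z1 - k * r) z2 <= a * d - b ^+ 2.
    by apply: stadium_mem => // s' t'; have := W_le _ s' t' Wz.
  set x1 := z1 - k * r in le.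
  (* [B] is the polar form of the two points; equality in the support bound forces [B = det], and
     then the form of their difference is at most 0. *)
  pose B := d * (x * x1) - b * (x * z2 + y * x1) + a * (y * z2).
  have hz' : B + r * (s * k) = r * (e * s) + det.
    by rewrite -hz /B /s /t /x1; ring.
  have n2 : qform d (- b) a (x1 - x) (z2 - y) =
     qform d (- b) a x1 z2 + qform d (- b) a x y - 2 * B.
    by rewrite /B /qform; ring.
  have n3 := qform_ge0 (x1 - x) (z2 - y) pd'.
  have Ble : B <= det by move: n3; rewrite n2 n1; move: le; rewrite -/det; lra.
  have rsk : r * (s * k) <= r * (e * s).
    rewrite ler_pM2l // -esn; apply: (le_trans (ler_norm _)).
    by rewrite normrM ler_piMr // ler_norml.
  have Be : B = det by lra.
  have ke : k = e.
    apply: (mulfI sn0); apply: (@mulfI _ r); first by rewrite gt_eqF.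
    by rewrite [s * e]mulrC; lra.
  have [x1x z2y] : x1 - x = 0 /\ z2 - y = 0.
    by apply: (qform_definite pd'); rewrite n2 n1 Be; move: le; rewrite -/det;
      lra.
  have -> : e * r + x = z1 by move: x1x; rewrite /x1 ke; lra.
  by have -> : y = z2 by lra.
have all (e x y : R) : e ^+ 2 = 1 -> qform d (- b) a x y = det ->
    W (Complex (e * r + x) y).
  move=> e2 n1; have [|es] := lerP 0 (e * (d * x - b * y)); first exact: outer.
  have o1 : W (Complex (- e * r + x) y).
    by apply: outer => //; rewrite ?sqrrN // mulNr oppr_ge0 ltW.
  (* The second intersection of the ellipse with the horizontal line through [(x, y)]; the inner
     point lies between those of [o1] and [o2]. *)
  pose x' := 2 * b * y / d - x.
  have o2 : W (Complex (e * r + x') y).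
    apply: outer => //.
      by rewrite -n1 /x' /qform; field.
    have -> : d * x' - b * y = - (d * x - b * y) by rewrite /x'; field.
    by rewrite mulrN oppr_ge0 ltW.
  pose u := - (e * (d * x - b * y)).
  have u0 : 0 < u by rewrite oppr_gt0.
  have dr0 : 0 < d * r by rewrite mulr_gt0.
  pose k := u / (u + d * r).
  have k01 : 0 <= k <= 1.
    rewrite /k divr_ge0 ?ler_pdivrMr ?addr_gt0 ?mul1r ?lerDl ?(ltW dr0) ?(ltW
      u0) //.
    by rewrite ltW // addr_gt0.
  have := cW _ _ k k01 o1 o2; set w := (X in W X).
  have -> // : w = Complex (e * r + x) y.
  have udr : u + d * r != 0 by rewrite gt_eqF // addr_gt0.
  rewrite /w; apply/eqP; rewrite eq_complex /= /k /x'.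
  have xE : x = (b * y - e * u) / d.
    apply: (@mulfI _ d) => //; have -> : d * ((b * y - e * u) / d) =
      b * y + e ^+ 2 * (d * x - b * y) by rewrite /u; field.
    by rewrite e2; ring.
  clearbody u; apply/andP; split; apply/eqP; rewrite ?xE; field; exact/andP.
move=> z; apply: convex_hull_min => // {}z.
rewrite /ell /=; case: z => z1 z2 [] /= e; move: (e).
  rewrite subr0 => /(all 1 _ _ (expr1n _ _)).
  by rewrite mul1r addrC subrK.
rewrite !opprK addr0 => /(all (-1) _ _).
by rewrite sqrrN expr1n mulN1r addrC addrK; apply.
Qed.

(** * Identities between support functions *)

(** In the direction [(e, 0)] the first translate reaches [r + Num.sqrt _], the second only
    [- r + Num.sqrt _]. *)
Lemma ell_translates_not_sub (R : realType) (a b d e r : R) :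
  posdef a b d -> 0 < r -> e ^+ 2 = 1 ->
  ~ ell a b d ((e * r)%:C%C) `<=` convex_hull (ell a b d (- (e * r)%:C%C)).
Proof.
move=> pd r0 e2 sub.
have [|z zE] := @ell_dir_attained R a b d (e * r)%:C%C e 0 pd.
  by rewrite orbC eqxx /=; apply/eqP => e0; move: e2; rewrite e0 expr0n /=; lra.
have := @convex_hull_min R (ell a b d (- (e * r)%:C%C)) _
  (@cvx_halfplane R e 0 (dir e 0 (- (e * r)%:C%C) + Num.sqrt (qform a b d e
    0))) _ z (sub _ zE).
move=> /(_ _)/= h hz; have := h (fun w wE => ell_dir_le e 0 pd wE).
rewrite hz /dir /= !mul0r !addr0 mulrN mulrA -expr2 e2 mul1r.
by rewrite lerD2r; lra.
Qed.

Lemma bi_elliptical_translates (R : realType) (a b d r : R) :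
  posdef a b d -> 0 < r ->
  bi_elliptical (convex_hull (ell a b d r%:C%C `|` ell a b d (- r%:C%C))).
Proof.
move=> pd r0.
exists (ell a b d r%:C%C), (ell a b d (- r%:C%C)), r%:C%C, (- r%:C%C).
split; split => //.
- by apply/is_ellipse_ell; exists a, b, d.
- by apply/is_ellipse_ell; exists a, b, d.
- by move/eqP; rewrite eq_complex /= => /andP[/eqP]; lra.
- by have := ell_translates_not_sub pd r0 (expr1n _ 2); rewrite mul1r.
- have := @ell_translates_not_sub _ a b d (-1) r pd r0.
  by rewrite sqrrN expr1n mulN1r rmorphN opprK => /(_ erefl).
Qed.

Lemma poly_eq0_near (R : realType) (p : {poly R}) (eps : R) :
  0 < eps -> (forall x, 0 < x < eps -> p.[x] = 0) -> p = 0.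
Proof.
move=> e0 h; apply/eqP; apply: contraT => pn0.
(* Starting with the divisor 2 keeps all sample points strictly below [eps]. *)
pose rs := [seq eps / (i.+2)%:R | i <- iota 0 (size p)].
have rsP : all (root p) rs.
  apply/allP => x /mapP[i _ ->]; apply/rootP/h.
  rewrite divr_gt0 //= ltr_pdivrMr // ltr_pMr //.
  by rewrite ltr1n.
have rsu : uniq rs.
  rewrite map_inj_uniq ?iota_uniq // => i j.
  move=> /(mulfI (lt0r_neq0 e0)) /invr_inj /eqP.
  by rewrite eqr_nat !eqSS => /eqP.
have := max_poly_roots pn0 rsP rsu.
by rewrite size_map size_iota ltnn.
Qed.

(* If q were nonzero, p / q would be a polynomial square root of g, hence of
   degree 1 and with a real zero, where g vanishes. *)
Lemma poly_sqrt_free (R : realType) (p q g : {poly R}) (eps : R) :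
  size g = 3%N -> (forall x, 0 < g.[x]) -> 0 < eps ->
  (forall x, 0 < x < eps -> p.[x] + q.[x] * Num.sqrt g.[x] = 0) ->
  p = 0 /\ q = 0.
Proof.
move=> sg gpos e0 h.
have e1 : p ^+ 2 = q ^+ 2 * g.
  apply/eqP; rewrite -subr_eq0; apply/eqP/(poly_eq0_near e0) => x xe.
  have := h x xe; move/eqP; rewrite addr_eq0 => /eqP hx.
  by rewrite !hornerE hx sqrrN exprMn sqr_sqrtr ?(ltW (gpos x)) // subrr.
have [q0|qn0] := eqVneq q 0.
  split=> //; move: e1; rewrite q0 expr0n /= mul0r => /eqP.
  by rewrite expf_eq0 => /eqP.
have : q ^+ 2 %| p ^+ 2 by rewrite e1 dvdp_mulr.
rewrite dvdp_pexp2r // => /dvdpP[T pT].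
have Tg : T ^+ 2 = g.
  apply: (@mulfI _ (q ^+ 2)); first by rewrite expf_neq0.
  by rewrite -e1 pT exprMn mulrC.
have sT : size T = 2%N.
  have Tn0 : T != 0 by apply/eqP => T0; move: sg;
    rewrite -Tg T0 expr0n /= size_poly0.
  have := sg; rewrite -Tg expr2 size_mul //.
  by case: (size T) => [|[|[|n]]] //=; rewrite !addnS.
have [x /rootP xr] := poly2_root sT.
by have := gpos x; rewrite -Tg !hornerE xr expr0n /= ltxx.
Qed.

(** An explicit [eps] for the openness of a strict inequality along a line: for [0 < x < 1] the
    perturbation is at most [(|b| + |c|) * x]. *)
Lemma quadratic_gt0_near (R : realType) (a b c : R) : 0 < a ->
  exists2 eps, 0 < eps & forall x, 0 < x < eps -> 0 < a + b * x + c * x ^+ 2.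
Proof.
move=> a0; have m0 : 0 < `|b| + `|c| + 1 by rewrite ltr_wpDl // addr_ge0.
exists (Num.min 1 (a / (`|b| + `|c| + 1))).
  by rewrite lt_min ltr01 divr_gt0.
move=> x /andP[x0]; rewrite lt_min => /andP[x1].
rewrite ltr_pdivlMr // => h.
have hb : - (`|b| * x) <= b * x.
  by rewrite -mulNr ler_wpM2r ?(ltW x0) // lerNl -normrN ler_norm.
have hc : - (`|c| * x) <= c * x ^+ 2.
  apply: (@le_trans _ _ (- `|c| * x ^+ 2)).
    rewrite mulNr lerN2 ler_wpM2l // expr2 ler_piMr // ltW //.
  by rewrite ler_wpM2r ?sqr_ge0 // lerNl -normrN ler_norm.
lra.
Qed.

Section SupportIdentity.
Context (R : realType).

(* Fifth finite differences of a polynomial of degree at most 4 vanish. *)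
Lemma finite_difference5 (f : R -> R -> R) (s t v w : R) :
  f s t = 5 * f (s + v) (t + w) - 10 * f (s + 2 * v) (t + 2 * w)
          + 10 * f (s + 3 * v) (t + 3 * w) - 5 * f (s + 4 * v) (t + 4 * w)
          + f (s + 5 * v) (t + 5 * w) ->
  (forall s' t', s' * v + t' * w != 0 -> f s' t' = 0) ->
  (v != 0) || (w != 0) -> f s t = 0.
Proof.
move=> fE h vw; have [k0|k] := eqVneq (s * v + t * w) 0; last exact: h.
have n0 : 0 < v ^+ 2 + w ^+ 2.
  rewrite lt0r addr_ge0 ?sqr_ge0 // andbT paddr_eq0 ?sqr_ge0 //.
  by rewrite !expf_eq0 /= negb_and.
have hj (j : R) : j != 0 -> f (s + j * v) (t + j * w) = 0.
  move=> j0; apply: h; have -> : (s + j * v) * v + (t + j * w) * w =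
    s * v + t * w + j * (v ^+ 2 + w ^+ 2) by ring.
  by rewrite k0 add0r mulf_neq0 // gt_eqF.
have h1 := hj 1; rewrite !mul1r in h1.
by rewrite fE h1 ?oner_neq0 // !hj ?pnatr_eq0 // !mulr0; ring.
Qed.

(** A point of [E1] outside the hull of [E2] gives a direction in which [E1] extends beyond [E2].
    This persists on an arc, where the support function of [W] is that of [E1]. There
    [poly_sqrt_free] separates the rational part from the coefficient of the square root; the
    resulting polynomial identities extend to all directions by homogeneity and finite
    differences. *)
Lemma support_identity (W E1 E2 : set R[i]) (a b d r : R) (c2 : R[i])
    (a' b' d' p1 p2 p3 x1 x2 x3 y1 y2 y3 z1 z2 z3 : R) :
  let p := qform p1 p2 p3 in
  let q s t := qform x1 y1 z1 s t ^+ 2 + qform x2 y2 z2 s t ^+ 2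
               + qform x3 y3 z3 s t ^+ 2 in
  (forall s t, 0 <= p s t) ->
  (forall z s t, W z -> dir s t z <= Num.sqrt (p s t + Num.sqrt (q s t))) ->
  (forall s t, exists2 z, W z & dir s t z = Num.sqrt (p s t
    + Num.sqrt (q s t))) ->
  posdef a b d -> posdef a' b' d' -> 0 < r ->
  E1 = ell a b d r%:C%C -> E2 = ell a' b' d' c2 ->
  ~ E1 `<=` convex_hull E2 -> W = convex_hull (E1 `|` E2) ->
  forall s t, p s t = r ^+ 2 * s ^+ 2 + qform a b d s t /\
    q s t = 4 * r ^+ 2 * s ^+ 2 * qform a b d s t.
Proof.
move=> p q.
have pE s t : p s t = qform p1 p2 p3 s t by [].
have qE s t : q s t = qform x1 y1 z1 s t ^+ 2 + qform x2 y2 z2 s t ^+ 2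
    + qform x3 y3 z3 s t ^+ 2 by [].
clearbody p q.
move=> p0 W_le W_att pd pd' r0 E1E E2E nsub WE.
have [z E1z nz] : exists2 z, E1 z & ~ convex_hull E2 z.
  apply: contrapT => h; apply: nsub => z E1z; apply: contrapT => nz.
  by apply: h; exists z.
set x := complex.Re (z - c2); set y := complex.Im (z - c2).
set det' := a' * d' - b' ^+ 2.
have [a'0 d'0 ad'] := pd'.
have det'0 : 0 < det' by rewrite subr_gt0.
have n0 : det' < qform d' (- b') a' x y.
  rewrite ltNge; apply/negP => le; apply: nz; rewrite E2E.
  exact: ell_disk_hull.
set n := qform _ _ _ _ _ in n0.
(* The normal at [z] of the ellipse through [z] concentric and homothetic to [E2]. In this direction
   [z] exceeds the centre [c2] by [n], but [E2] only by [Num.sqrt (det' * n)]. *)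
pose s1 := d' * x - b' * y; pose t1 := a' * y - b' * x.
have qs1 : qform a' b' d' s1 t1 = det' * n.
  by rewrite /n /det' /qform /s1 /t1; ring.
have ns1 : s1 * x + t1 * y = n by rewrite /n /qform /s1 /t1; ring.
have st1 : (s1 != 0) || (t1 != 0).
  apply: contraT; rewrite negb_or !negbK => /andP[/eqP s10 /eqP t10].
  by move: ns1 n0 det'0; rewrite s10 t10 !mul0r addr0 => <-; lra.
(* The line of directions through [(s1, t1)] orthogonal to that vector; along it all forms become
   polynomials in [k]. *)
pose s k := s1 - k * t1; pose t k := t1 + k * s1.
have nst k : (s k != 0) || (t k != 0).
  apply: contraT; rewrite negb_or !negbK => /andP[/eqP sk /eqP tk].
  have : s1 * s k + t1 * t k = s1 ^+ 2 + t1 ^+ 2 by rewrite /s /t; ring.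
  rewrite sk tk !mulr0 addr0 => /esym/eqP.
  rewrite paddr_eq0 ?sqr_ge0 // !expf_eq0 /= => /andP[s10 t10].
  by move: st1; rewrite s10 t10.
have [eps1 e10 h1] : exists2 eps, 0 < eps & forall k, 0 < k < eps ->
    0 < s k * x + t k * y.
  have [|eps e0 h] := @quadratic_gt0_near _ n (s1 * y - t1 * x) 0.
    exact: lt_trans n0.
  exists eps => // k /h.
  have -> // : s k * x + t k * y = n + (s1 * y - t1 * x) * k + 0 * k ^+ 2.
  by rewrite -ns1 /s /t; ring.
have [eps2 e20 h2] : exists2 eps, 0 < eps & forall k, 0 < k < eps ->
    qform a' b' d' (s k) (t k) < (s k * x + t k * y) ^+ 2.
  pose m := s1 * y - t1 * x.
  have [|eps e0 h] := @quadratic_gt0_near _ (n ^+ 2 - det' * n)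
     (2 * n * m - 2 * (b' * (s1 ^+ 2 - t1 ^+ 2) + (d' - a') * s1 * t1))
     (m ^+ 2 - qform a' b' d' (- t1) s1).
    by rewrite expr2 -mulrBl mulr_gt0 ?subr_gt0 // (lt_trans det'0).
  exists eps => // k /h hk; rewrite -subr_gt0.
  have -> // : (s k * x + t k * y) ^+ 2 - qform a' b' d' (s k) (t k) =
    n ^+ 2 - det' * n + (2 * n * m - 2 * (b' * (s1 ^+ 2 - t1 ^+ 2)
      + (d' - a') * s1 * t1)) * k + (m ^+ 2 - qform a' b' d' (- t1) s1)
        * k ^+ 2.
  by rewrite -qs1 -ns1 /m /s /t /qform; ring.
have sq0 u v : 0 <= Num.sqrt (q u v) by exact: sqrtr_ge0.
have h12 k : 0 < k < Num.min eps1 eps2 ->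
  r * s k + Num.sqrt (qform a b d (s k) (t k)) =
  Num.sqrt (p (s k) (t k) + Num.sqrt (q (s k) (t k))).
  move=> /andP[k0]; rewrite lt_min => /andP[ke1 ke2].
  have hk1 := h1 k; rewrite k0 ke1 in hk1; have {}hk1 := hk1 isT.
  have hk2 := h2 k; rewrite k0 ke2 in hk2; have {}hk2 := hk2 isT.
  have hk3 : Num.sqrt (qform a' b' d' (s k) (t k)) < s k * x + t k * y.
    rewrite -(ger0_norm (ltW hk1)) -sqrtr_sqr ltr_sqrt //.
    by rewrite exprn_gt0.
  have dr : dir (s k) (t k) r%:C%C = r * s k by rewrite /dir /= mulr0 addr0
    mulrC.
  have E1le w : E1 w -> dir (s k) (t k) w <=
      r * s k + Num.sqrt (qform a b d (s k) (t k)).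
    by rewrite E1E -dr; exact: ell_dir_le.
  have dz : dir (s k) (t k) z = dir (s k) (t k) c2 + (s k * x + t k * y).
    by rewrite /x /y /dir; case: (z) (c2) => [? ?] [? ?] /=; ring.
  have Wle w : W w -> dir (s k) (t k) w <=
      r * s k + Num.sqrt (qform a b d (s k) (t k)).
    rewrite WE; move: w; apply: convex_hull_min; first exact: cvx_halfplane.
    move=> w [/E1le //|]; rewrite E2E => /(ell_dir_le (s k) (t k) pd').
    by move: (E1le z E1z); rewrite dz /=; lra.
  apply/eqP; rewrite eq_le; apply/andP; split.
    have [w wE] := ell_dir_attained r%:C%C pd (nst k).
    rewrite dr => <-; apply: W_le.
    by rewrite WE; apply: sub_convex_hull; left; rewrite E1E.
  by have [w Ww <-] := W_att (s k) (t k); exact: Wle.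
have hE := (@hornerD R, @hornerN R, @hornerZ R, @hornerM R, @horner_exp R,
  @hornerC R, @hornerX R, @hornerXn R).
have [S SE] : exists S : {poly R}, forall k, S.[k] = s k.
  by exists (s1%:P - t1 *: 'X) => k; rewrite /s !hE; ring.
have [T TE] : exists T : {poly R}, forall k, T.[k] = t k.
  by exists (t1%:P + s1 *: 'X) => k; rewrite /t !hE; ring.
have [Q QE] : exists Q : R -> R -> R -> {poly R}, forall u v w k,
    (Q u v w).[k] = qform u v w (s k) (t k).
  exists (fun u v w => u *: S ^+ 2 + (2 * v) *: (S * T) + w *: T ^+ 2).
  move=> u v w k; rewrite !hE SE TE /qform.
  by ring.
(* [e] is the defect of the identity for [p]. Squaring the support equation twice gives
   [q = (e + 2 * r * s * sqrt g) ^+ 2], where [g] is [qform a b d]. *)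
pose e : {poly R} := r ^+ 2 *: S ^+ 2 + Q a b d - Q p1 p2 p3.
have [qq qqE] : exists qq : {poly R}, forall k, qq.[k] = q (s k) (t k).
  exists (Q x1 y1 z1 ^+ 2 + Q x2 y2 z2 ^+ 2 + Q x3 y3 z3 ^+ 2) => k.
  by rewrite !hE !QE qE.
have [||||] := @poly_sqrt_free _ (e ^+ 2 + (4 * r ^+ 2) *:
  (S ^+ 2 * Q a b d) - qq)
   ((4 * r) *: (e * S)) (Q a b d) (Num.min eps1 eps2).
- have sE : Q a b d = (qform a b d (- t1) s1) *: 'X^2
     + (2 * (b * (s1 ^+ 2 - t1 ^+ 2) + (d - a) * s1 * t1)) *: 'X
     + (qform a b d s1 t1)%:P.
    apply/eqP; rewrite -subr_eq0; apply/eqP/(poly_eq0_near ltr01) => k _.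
    by rewrite !hE QE /s /t /qform; ring.
  rewrite sE -addrA; have lc : qform a b d (- t1) s1 != 0.
    by rewrite gt_eqF // qform_gt0 // oppr_eq0 orbC.
  rewrite size_polyDl size_scale // size_polyXn // ltnS.
  apply: leq_trans (size_polyD _ _) _; rewrite geq_max.
  rewrite (leq_trans (size_scale_leq _ _)) ?size_polyX //.
  by rewrite (leq_trans (size_polyC_leq1 _)).
- by move=> k; rewrite QE; exact: qform_gt0.
- by rewrite lt_min e10.
- move=> k /h12 hk; rewrite !hE !QE qqE SE.
  set g := qform a b d _ _ in hk *.
  have g0 : 0 <= g by apply: qform_ge0.
  have := congr1 (fun z => z ^+ 2) hk; rewrite /= sqr_sqrtr ?addr_ge0 //.
  rewrite sqrrD exprMn [Num.sqrt g ^+ 2]sqr_sqrtr // pE => hk2.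
  have hq : Num.sqrt (q (s k) (t k)) = r ^+ 2 * s k ^+ 2 + g
    - qform p1 p2 p3 (s k) (t k)
     + 2 * (r * s k) * Num.sqrt g by rewrite -mulr_natl in hk2; lra.
  have qge : 0 <= q (s k) (t k) by rewrite qE !addr_ge0 ?sqr_ge0.
  rewrite -[X in _ - X](sqr_sqrtr qge) hq.
  set f := r ^+ 2 * s k ^+ 2 + g - _; set h := Num.sqrt g.
  have -> : g = h ^+ 2 by rewrite sqr_sqrtr.
  ring.
move=> P0 Q0.
have Sn0 : S != 0.
  apply/eqP => S0; move: st1; have := SE 0; have := SE 1.
  rewrite S0 !horner0 /s mul0r subr0 mul1r => h /esym s10.
  by move: h; rewrite s10 sub0r eqxx => /eqP; rewrite eq_sym oppr_eq0 => ->.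
have e0 : e = 0.
  move: Q0 => /eqP; rewrite scaler_eq0 !mulf_eq0 (negbTE Sn0) orbF pnatr_eq0.
  by rewrite (gt_eqF r0) => /eqP.
have pk k : p (s k) (t k) = r ^+ 2 * s k ^+ 2 + qform a b d (s k) (t k).
  have := congr1 (fun e => e.[k]) e0; rewrite /= /e !hE !QE SE pE; lra.
have qk k : q (s k) (t k) = 4 * r ^+ 2 * s k ^+ 2 * qform a b d (s k) (t k).
  have := congr1 (fun e => e.[k]) P0; rewrite /= e0 !hE qqE QE SE; lra.
(* Every direction not orthogonal to [(s1, t1)] is a multiple of one on the line; the orthogonal
   ones are left to [finite_difference5]. *)
have ratio u v : u * s1 + v * t1 != 0 -> exists l k, u = l * s k /\ v = l * t k.
  move=> k0; have n1 : s1 ^+ 2 + t1 ^+ 2 != 0.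
    apply: contraNneq k0 => /eqP; rewrite paddr_eq0 ?sqr_ge0 // !expf_eq0 /=.
    by move=> /andP[/eqP -> /eqP ->]; rewrite !mulr0 addr0.
  exists ((u * s1 + v * t1) / (s1 ^+ 2 + t1 ^+ 2)), ((v * s1
    - u * t1) / (u * s1 + v * t1)).
  by rewrite /s /t; split; field; apply/andP.
move=> u v; split; apply/eqP; rewrite -subr_eq0; apply/eqP.
  apply: (@finite_difference5 (fun u v => p u v - (r ^+ 2 * u ^+ 2
    + qform a b d u v)) u v s1 t1) => //.
    by rewrite !pE /qform; ring.
  move=> {}u {}v /ratio[l [k [-> ->]]]; apply/eqP; rewrite subr_eq0; apply/eqP.
  have := congr1 (fun z => l ^+ 2 * z) (pk k); rewrite /= !pE /qform => h.
  by etransitivity; [|etransitivity; [exact: h|]]; ring.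
apply: (@finite_difference5 (fun u v
  => q u v - (4 * r ^+ 2 * u ^+ 2 * qform a b d u v)) u v s1 t1) => //.
  by rewrite !qE /qform; ring.
move=> {}u {}v /ratio[l [k [-> ->]]]; apply/eqP; rewrite subr_eq0; apply/eqP.
have := congr1 (fun z => l ^+ 4 * z) (qk k); rewrite /= !qE /qform => h.
by etransitivity; [|etransitivity; [exact: h|]]; ring.
Qed.
End SupportIdentity.

(** * Convexity of the numerical range *)

Lemma conjC_real (R : realType) (x : R) : Num.conj (x%:C%C : R[i]) = x%:C%C.
Proof. exact: conjc_real. Qed.

Lemma realC_eq0 (R : realType) (x : R) : (x%:C%C == 0 :> R[i]) = (x == 0).
Proof. by rewrite -(rmorph0 (real_complex R)) (inj_eq (@complexI R)). Qed.

Lemma ord2P (k : 'I_2) : k = 0 \/ k = 1.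
Proof. by case: k => [[|[|//]] ?]; [left|right]; apply/val_inj. Qed.

Definition cdot (R : realType) (n : nat) (x y : 'cV[R[i]]_n) : R[i] :=
  (x ^t* *m y) 0 0.

Section Cdot.
Context (R : realType) (n : nat).
Implicit Types (x y z : 'cV[R[i]]_n) (a : R[i]).

Lemma cdotE x y : cdot x y = \sum_i Num.conj (x i 0) * y i 0.
Proof. by rewrite /cdot mxE; apply: eq_bigr => i _; rewrite !mxE. Qed.

Lemma cdotDl x y z : cdot (x + y) z = cdot x z + cdot y z.
Proof. by rewrite /cdot linearD /= map_mxD mulmxDl mxE. Qed.

Lemma cdotDr x y z : cdot z (x + y) = cdot z x + cdot z y.
Proof. by rewrite /cdot mulmxDr mxE. Qed.

Lemma cdotZl a x y : cdot (a *: x) y = Num.conj a * cdot x y.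
Proof. by rewrite /cdot linearZ /= map_mxZ -scalemxAl mxE. Qed.

Lemma cdotZr a x y : cdot x (a *: y) = a * cdot x y.
Proof. by rewrite /cdot -scalemxAr mxE. Qed.

Lemma cdotC x y : cdot y x = Num.conj (cdot x y).
Proof.
by rewrite !cdotE rmorph_sum; apply: eq_bigr => i _;
  rewrite rmorphM /= conjCK mulrC.
Qed.

Lemma cdot_ge0 x : 0 <= cdot x x.
Proof. by rewrite cdotE sumr_ge0 // => i _; rewrite mulrC mul_conjC_ge0. Qed.

Lemma cdot_eq0 x : (cdot x x == 0) = (x == 0).
Proof.
apply/eqP/eqP => [|->]; last by rewrite /cdot mulmx0 mxE.
rewrite cdotE => /eqP; rewrite psumr_eq0 => [|i _];
  last by rewrite mulrC mul_conjC_ge0.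
move=> /allP h; apply/matrixP => i j; rewrite ord1 mxE.
have := h i (mem_index_enum i); rewrite /= mulf_eq0 conjC_eq0 orbb.
by move/eqP.
Qed.

Lemma cdot_real x : (complex.Re (cdot x x))%:C%C = cdot x x.
Proof. by apply/RRe_real/ger0_real/cdot_ge0. Qed.

End Cdot.

Lemma cdot_adjoint (R : realType) (m n : nat) (M : 'M[R[i]]_(m, n))
    (x : 'cV[R[i]]_m) (y : 'cV[R[i]]_n) :
  cdot x (M *m y) = cdot (M ^t* *m x) y.
Proof.
rewrite /cdot mulmxA; congr ((_ *m _) 0 0).
by rewrite trmx_mul map_mxM /= trmxCK.
Qed.

(** A homogeneous form of the definition: the normalisation by the square root of [cdot x x] is done
    here once and for all. *)
Lemma numerical_rangeE (R : realType) (n : nat) (A : 'M[R[i]]_n) (z : R[i]) :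
  numerical_range A z <->
  exists x, cdot x x != 0 /\ z * cdot x x = cdot x (A *m x).
Proof.
split=> [[x x1 ->]|[x [x0 xz]]].
  by exists x; rewrite /cdot x1 mulr1 oner_eq0.
have xg0 : 0 < cdot x x by rewrite lt0r x0 cdot_ge0.
pose c := (sqrtC (cdot x x))^-1.
have c0 : 0 <= c by rewrite invr_ge0 sqrtC_ge0 ltW.
have cc : Num.conj c = c by apply/CrealP/ger0_real.
have c2 : c * c = (cdot x x)^-1 by rewrite -expr2 exprVn sqrtCK.
exists (c *: x); first by rewrite -/(cdot _ _) cdotZl cdotZr cc mulrA c2 mulVf.
by rewrite -/(cdot _ _) -scalemxAr cdotZl cdotZr cc mulrA c2 -xz mulrC mulfK.
Qed.

(* Toeplitz-Hausdorff: for unit vectors x, y with values p <> q and a suitable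
   phase mu, the value at s x + mu y minus a prescribed point of the segment
   [p, q] is p - q times a real quadratic polynomial in s. *)
Lemma numerical_range_cvx (R : realType) (n : nat) (A : 'M[R[i]]_n) :
  cvx (numerical_range A).
Proof.
move=> p q k /andP[k0 k1] [x x1 pE] [y y1 qE].
have [kE|kn1] := eqVneq k 1.
  by rewrite kE subrr mul0r addr0 mul1r; exists x.
have {}k1 : 0 < 1 - k by rewrite subr_gt0 lt_neqAle kn1.
have [pq|pq] := eqVneq p q.
  by rewrite -pq -mulrDl -rmorphD addrC subrK mul1r; exists x.
have d0 : p - q != 0 by rewrite subr_eq0.
set z := _ + _.
have [g1 g1E] : exists g, g = (cdot x (A *m y) - z * cdot x y) / (p - q).
  by eexists.
have [g2 g2E] : exists g, g = (cdot y (A *m x) - z * cdot y x) / (p - q).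
  by eexists.
(* The cross term is real exactly when [mu * w] is, which dictates the phase [mu]. *)
have [mu [mu1 [e muE]]] : exists mu : R[i], mu * Num.conj mu = 1 /\
    exists e : R, mu * g1 + Num.conj mu * g2 = e%:C%C.
  pose w := g1 - Num.conj g2.
  have [w0|wn0] := eqVneq w 0.
    exists 1; rewrite rmorph1 !mul1r; split=> //.
    exists (complex.Re (g1 + g2)); apply/esym/RRe_real.
    move/eqP: w0; rewrite subr_eq0 => /eqP ->; apply/CrealP.
    by rewrite rmorphD /= conjCK addrC.
  have nw0 : `|w| != 0 by rewrite normr_eq0.
  have nw : Num.conj `|w| = `|w| by apply/CrealP/ger0_real.
  have nw2 : w * Num.conj w = `|w| ^+ 2 by rewrite normCK.
  exists (Num.conj w / `|w|); rewrite !rmorphM fmorphV /= nw conjCK; split.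
    by rewrite mulrACA [_ * w]mulrC nw2; field.
  eexists; apply/esym/RRe_real; apply/CrealP.
  rewrite rmorphD !rmorphM !fmorphV /= nw conjCK.
  apply/eqP; rewrite -subr_eq0; apply/eqP.
  have wc : Num.conj w = Num.conj g1 - g2 by rewrite /w rmorphB /= conjCK.
  rewrite wc; move: nw0; set N := `|w| => nw0; rewrite /w.
  by field.
pose D := e ^+ 2 + 4 * k * (1 - k).
(* A root of the quadratic in [sE]; [0 <= k < 1] makes the discriminant [D] nonnegative. *)
pose s := (- e + Num.sqrt D) / (2 * (1 - k)).
have D0 : 0 <= D by rewrite addr_ge0 ?sqr_ge0 // mulr_ge0 ?(ltW k1) // mulr_ge0.
have sE : (1 - k) * s ^+ 2 + e * s - k = 0.
  have := sqr_sqrtr D0; rewrite /s; set h := Num.sqrt D => hE.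
  have -> : (1 - k) * ((- e + h) / (2 * (1 - k))) ^+ 2
    + e * ((- e + h) / (2 * (1 - k))) - k = (h ^+ 2 - D) / (4 * (1 - k)).
    by rewrite /D; field; rewrite gt_eqF.
  by rewrite hE subrr mul0r.
have sc : Num.conj (s%:C%C : R[i]) = s%:C%C by exact: conjC_real.
pose f := s%:C%C *: x + mu *: y.
have fM M : cdot f (M *m f) = s%:C%C ^+ 2 * cdot x (M *m x) + cdot y (M *m y)
    + s%:C%C * (mu * cdot x (M *m y) + Num.conj mu * cdot y (M *m x)).
  rewrite /f mulmxDr -!scalemxAr !(cdotDl, cdotDr) !(cdotZl, cdotZr) sc.
  have -> : Num.conj mu * (mu * cdot y (M *m y)) = cdot y (M *m y).
    by rewrite mulrA [_ * mu]mulrC mu1 mul1r.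
  by ring.
have f1 : cdot f f = s%:C%C ^+ 2 + 1
    + s%:C%C * (mu * cdot x y + Num.conj mu * cdot y x).
  have := fM 1%:M; rewrite !mul1mx => ->.
  by rewrite [cdot x x]x1 [cdot y y]y1 mulr1.
have fA : cdot f (A *m f) = s%:C%C ^+ 2 * p + q
    + s%:C%C * (mu * cdot x (A *m y) + Num.conj mu * cdot y (A *m x)).
  by rewrite fM pE qE.
apply/numerical_rangeE; exists f; split.
  (* If the combination vanished, [y] would be proportional to [x], and [p] would equal [q]. *)
  rewrite cdot_eq0; apply/eqP => f0.
  have yE : mu *: y = (- s%:C%C) *: x.
    by apply/eqP; rewrite scaleNr -addr_eq0 addrC; apply/eqP.
  have h M : cdot y (M *m y) = s%:C%C ^+ 2 * cdot x (M *m x).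
    have : cdot (mu *: y) (M *m (mu *: y)) = cdot ((- s%:C%C) *:
      x) (M *m ((- s%:C%C) *: x)) by rewrite yE.
    rewrite -!scalemxAr !(cdotZl, cdotZr) mulrA [_ * mu]mulrC mu1 mul1r rmorphN
      /= sc => ->.
    by ring.
  have := h 1%:M; rewrite !mul1mx [cdot x x]x1 [cdot y y]y1 mulr1 => s2.
  have := h A; rewrite -s2 mul1r [cdot x _](esym pE) [cdot y _](esym qE).
  by move/eqP; rewrite eq_sym (negbTE pq).
apply/eqP; rewrite eq_sym -subr_eq0; apply/eqP.
have -> : cdot f (A *m f) - z * cdot f f = (p - q) *
   ((1 - k)%:C%C * s%:C%C ^+ 2 + (mu * g1 + Num.conj mu * g2) * s%:C%C
     - k%:C%C).
  by rewrite f1 fA g1E g2E /z rmorphB rmorph1; field.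
by rewrite muE -!(rmorphXn, rmorphM, rmorphD, rmorphB) /= sE rmorph0 mulr0.
Qed.

(** * Real inner products and block matrices *)

Definition rdot (R : realType) (n : nat) (x y : 'cV[R[i]]_n) : R :=
  complex.Re (cdot x y).

Section Rdot.
Context (R : realType) (n : nat).
Implicit Types (x y z : 'cV[R[i]]_n) (a : R).

Lemma rdotC x y : rdot y x = rdot x y.
Proof. by rewrite /rdot cdotC; case: (cdot x y). Qed.

Lemma rdotDr x y z : rdot z (x + y) = rdot z x + rdot z y.
Proof. by rewrite /rdot cdotDr raddfD. Qed.

Lemma rdotDl x y z : rdot (x + y) z = rdot x z + rdot y z.
Proof. by rewrite rdotC rdotDr ![rdot z _]rdotC. Qed.

Lemma rdotZr a x y : rdot x (a%:C%C *: y) = a * rdot x y.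
Proof. by rewrite /rdot cdotZr; case: (cdot x y) => u v /=; ring. Qed.

Lemma rdotZl a x y : rdot (a%:C%C *: x) y = a * rdot x y.
Proof. by rewrite rdotC rdotZr rdotC. Qed.

Lemma rdot_ge0 x : 0 <= rdot x x.
Proof. by rewrite -(ler0c (rdot x x)) /rdot cdot_real cdot_ge0. Qed.

Lemma rdot_eq0 x : (rdot x x == 0) = (x == 0).
Proof. by rewrite -cdot_eq0 -cdot_real -(inj_eq (@complexI R)). Qed.

Lemma rdot_cauchy x y : rdot x y ^+ 2 <= rdot x x * rdot y y.
Proof.
have [->|yn0] := eqVneq y 0.
  rewrite -(scale0r (0 : 'cV_n)) -(rmorph0 (real_complex R)) !rdotZr !mul0r.
  by rewrite expr0n mulr0.
have y0 : 0 < rdot y y by rewrite lt0r rdot_eq0 yn0 rdot_ge0.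
have := rdot_ge0 ((rdot y y)%:C%C *: x + (- rdot x y)%:C%C *: y).
rewrite !(rdotDl, rdotDr) !(rdotZl, rdotZr) [rdot y x]rdotC.
move: (rdot y y) (rdot x y) (rdot x x) y0 => a b c a0.
rewrite [X in 0 <= X](_ : _ = a * (c * a - b ^+ 2)); last by ring.
by rewrite pmulr_rge0 // subr_ge0.
Qed.
End Rdot.

Lemma rdot_adjoint (R : realType) (m n : nat) (M : 'M[R[i]]_(m, n))
    (x : 'cV[R[i]]_m) (y : 'cV[R[i]]_n) :
  rdot x (M *m y) = rdot (M ^t* *m x) y.
Proof. by rewrite /rdot cdot_adjoint. Qed.

(** [re_part] and [im_part] are the upper right blocks of Re A and Im A when [C] and [D] are the
    off-diagonal blocks of A; they are not the Hermitian parts of [C] alone. *)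
Definition re_part (R : realType) (n : nat) (C D : 'M[R[i]]_n) : 'M[R[i]]_n :=
  2^-1 *: (C + D ^t*).

Definition im_part (R : realType) (n : nat) (C D : 'M[R[i]]_n) : 'M[R[i]]_n :=
  (2 * 'i)^-1 *: (C - D ^t*).

Lemma re_im_part (R : realType) (n : nat) (C D : 'M[R[i]]_n) :
  C = re_part C D + 'i *: im_part C D /\
  D ^t* = re_part C D - 'i *: im_part C D.
Proof.
have i0 : ('i : R[i]) != 0 by rewrite neq0Ci.
by split; apply/matrixP => j k; rewrite !mxE; field.
Qed.

Section BlockRange.
Context (R : realType) (n : nat) (alpha : R[i]) (C D : 'M[R[i]]_n).
Let A : 'M[R[i]]_(n + n) := block_mx alpha%:M C D (- alpha)%:M.
Let a := complex.Re alpha.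
Let b := complex.Im alpha.
Let L := re_part C D.
Let G := im_part C D.

Lemma cdot_block (y w : 'cV[R[i]]_n) :
  cdot (col_mx y w) (A *m col_mx y w) =
  Complex (a * (rdot y y - rdot w w) + 2 * rdot y (L *m w))
          (b * (rdot y y - rdot w w) + 2 * rdot y (G *m w)).
Proof.
have colE (x z u v : 'cV[R[i]]_n) :
    cdot (col_mx x z) (col_mx u v) = cdot x u + cdot z v.
  by rewrite /cdot tr_col_mx map_row_mx mul_row_col mxE.
rewrite mul_block_col colE !mul_scalar_mx !cdotDr !cdotZr.
have -> : cdot w (D *m y) = Num.conj (cdot y (D ^t* *m w)).
  by rewrite -cdotC cdot_adjoint.
have [CE DE] := re_im_part C D.
rewrite CE DE -/L -/G; move: (L) (G) => L' G' {CE DE}.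
rewrite mulmxDl mulmxBl -!scalemxAl -scaleNr !cdotDr !cdotZr.
rewrite -[cdot y y]cdot_real -[cdot w w]cdot_real -!/(rdot _ _) /rdot.
case: (cdot y (L' *m w)) => l1 l2; case: (cdot y (G' *m w)) => g1 g2.
rewrite /a /b; case: (alpha) => a1 a2.
by apply/eqP; rewrite eq_complex /=; apply/andP; split; apply/eqP; ring.
Qed.

Lemma block_rangeP (z : R[i]) :
  numerical_range A z <->
  exists y w : 'cV[R[i]]_n, rdot y y + rdot w w != 0 /\
    (complex.Re z * (rdot y y + rdot w w)
       = a * (rdot y y - rdot w w) + 2 * rdot y (L *m w) /\
     complex.Im z * (rdot y y + rdot w w)
       = b * (rdot y y - rdot w w) + 2 * rdot y (G *m w)).
Proof.
have nE (y w : 'cV[R[i]]_n) :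
    cdot (col_mx y w) (col_mx y w) = (rdot y y + rdot w w)%:C%C.
  rewrite rmorphD /= /rdot !cdot_real /cdot tr_col_mx map_row_mx mul_row_col.
  by rewrite mxE.
split=> [/numerical_rangeE[x []]|[y [w [n0 [h1 h2]]]]].
  rewrite -[x]vsubmxK cdot_block nE; set y := usubmx x; set w := dsubmx x.
  move=> n0 h; exists y, w; split.
    by apply: contraNneq n0 => ->; rewrite rmorph0.
  move/eqP: h; case: (z) => z1 z2; rewrite eq_complex /= => /andP[/eqP <- /eqP
    <-].
  by split; ring.
apply/numerical_rangeE; exists (col_mx y w).
rewrite cdot_block nE realC_eq0; split=> //.
rewrite -h1 -h2; case: (z) => z1 z2; apply/eqP; rewrite eq_complex /=.
by apply/andP; split; apply/eqP; ring.
Qed.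

End BlockRange.

(** * The support function of the numerical range *)

(* Coordinates of the Hermitian part of M on the identity and the three Pauli
   matrices. *)
Definition pauli0 (R : realType) (M : 'M[R[i]]_2) : R :=
  (complex.Re (M 0 0) + complex.Re (M 1 1)) / 2.
Definition pauli1 (R : realType) (M : 'M[R[i]]_2) : R :=
  (complex.Re (M 0 1) + complex.Re (M 1 0)) / 2.
Definition pauli2 (R : realType) (M : 'M[R[i]]_2) : R :=
  (complex.Im (M 1 0) - complex.Im (M 0 1)) / 2.
Definition pauli3 (R : realType) (M : 'M[R[i]]_2) : R :=
  (complex.Re (M 0 0) - complex.Re (M 1 1)) / 2.
Definition pauli_norm (R : realType) (M : 'M[R[i]]_2) : R :=
  Num.sqrt (pauli1 M ^+ 2 + pauli2 M ^+ 2 + pauli3 M ^+ 2).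

Lemma cdot2E (R : realType) (x y : 'cV[R[i]]_2) :
  cdot x y = Num.conj (x 0 0) * y 0 0 + Num.conj (x 1 0) * y 1 0.
Proof.
rewrite cdotE !big_ord_recl big_ord0 addr0.
by have -> : lift ord0 ord0 = 1 :> 'I_2 by apply/val_inj.
Qed.

Lemma mulmx2E (R : pzSemiRingType) (m n : nat) (A : 'M[R]_(m, 2))
    (B : 'M[R]_(2, n)) i j :
  (A *m B) i j = A i 0 * B 0 j + A i 1 * B 1 j.
Proof.
rewrite mxE !big_ord_recl big_ord0 addr0.
by have -> : lift ord0 ord0 = 1 :> 'I_2 by apply/val_inj.
Qed.

Section Pauli.
Context (R : realType).
Implicit Types (M : 'M[R[i]]_2) (y : 'cV[R[i]]_2).

Let bloch1 y := 2 * complex.Re (Num.conj (y 0 0) * y 1 0).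
Let bloch2 y := 2 * complex.Im (Num.conj (y 0 0) * y 1 0).
Let bloch3 y := complex.Re (Num.conj (y 0 0) * y 0 0)
              - complex.Re (Num.conj (y 1 0) * y 1 0).

Lemma pauli_form M y :
  rdot y (M *m y) = pauli0 M * rdot y y
    + (pauli1 M * bloch1 y + pauli2 M * bloch2 y + pauli3 M * bloch3 y).
Proof.
rewrite /rdot !cdot2E !mulmx2E /pauli0 /pauli1 /pauli2 /pauli3 /bloch1 /bloch2
  /bloch3.
case: (y 0 0) (y 1 0) => [a b] [c d].
case: (M 0 0) (M 0 1) (M 1 0) (M 1 1) => [? ?] [? ?] [? ?] [? ?] /=.
by field.
Qed.

(** Cauchy-Schwarz in three dimensions: the Bloch vector of [y] has length [rdot y y]. *)
Lemma pauli_form_le M y : rdot y (M *m y) <= (pauli0 M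
  + pauli_norm M) * rdot y y.
Proof.
rewrite pauli_form mulrDl lerD2l; apply: (le_trans (ler_norm _)).
have yy : 0 <= rdot y y by exact: rdot_ge0.
rewrite -[leRHS]ger0_norm ?mulr_ge0 ?sqrtr_ge0 //.
rewrite -[leLHS]sqrtr_sqr -[leRHS]sqrtr_sqr ler_sqrt ?sqr_ge0 //.
rewrite exprMn sqr_sqrtr ?addr_ge0 ?sqr_ge0 //.
have -> : rdot y y ^+ 2 = bloch1 y ^+ 2 + bloch2 y ^+ 2 + bloch3 y ^+ 2.
  rewrite /rdot !cdot2E /bloch1 /bloch2 /bloch3.
  by case: (y 0 0) (y 1 0) => [a b] [c d] /=; ring.
rewrite -subr_ge0.
move: (pauli1 M) (pauli2 M) (pauli3 M) (bloch1 y) (bloch2 y) (bloch3 y)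
  => a b c d e f.
rewrite [X in 0 <= X](_ : _ = (a * e - b * d) ^+ 2 + (a * f - c * d) ^+ 2
  + (b * f - c * e) ^+ 2).
  by rewrite !addr_ge0 ?sqr_ge0.
by ring.
Qed.

(** The signs of [e] give the two eigenvalues of the Hermitian part, with eigenvector
    [(u + pauli3, pauli1 + i pauli2)]. *)
Lemma pauli_form_attained M (e : R) : e ^+ 2 = 1 ->
  exists2 y, 0 < rdot y y
    & rdot y (M *m y) = (pauli0 M + e * pauli_norm M) * rdot y y.
Proof.
move=> e2; pose u := e * pauli_norm M.
have u2 : u ^+ 2 = pauli1 M ^+ 2 + pauli2 M ^+ 2 + pauli3 M ^+ 2.
  by rewrite exprMn e2 mul1r sqr_sqrtr // !addr_ge0 ?sqr_ge0.
rewrite -/u; clearbody u.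
(* In this case that vector vanishes, and the second basis vector takes its place. *)
have [h|h] := eqVneq (u + pauli3 M) 0.
  exists (\col_i (if i == 0 then 0 else 1)).
    rewrite /rdot cdot2E !mxE /=. by rewrite !(mul0r, mulr0, mulr1, oppr0,
      subr0, addr0, add0r).
  rewrite pauli_form /rdot /bloch1 /bloch2 /bloch3 cdot2E !mxE /=.
  move/eqP: h; rewrite addr_eq0 => /eqP ->; ring.
exists (\col_i (if i == 0 then (u + pauli3 M)%:C%C else Complex (pauli1 M)
  (pauli2 M))).
  rewrite lt0r rdot_ge0 andbT rdot_eq0; apply/eqP => /matrixP/(_ 0 0).
  by rewrite !mxE /= => /complexI /eqP; rewrite (negbTE h).
rewrite pauli_form /rdot /bloch1 /bloch2 /bloch3 cdot2E !mxE /=.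
apply/eqP; rewrite -subr_eq0; apply/eqP.
rewrite [LHS](_ : _ = (pauli3 M + u) * (pauli1 M ^+ 2 + pauli2 M ^+ 2
  + pauli3 M ^+ 2 - u ^+ 2)); last by ring.
by rewrite u2 subrr mulr0.
Qed.

End Pauli.

(** With [j = h ^+ 2 - k ^+ 2], [d = Y - W] and [f = 4 * (Y * W)], squaring reduces the claim to [(k
    * d + 2 * e) ^+ 2 <= (k ^+ 2 + j) * (d ^+ 2 + f)]. This is Cauchy-Schwarz, given
    [(2 * e) ^+ 2 <= j * f]. *)
Lemma direction_max_le (R : realType) (k h Y W e : R) :
  0 <= h -> k ^+ 2 <= h ^+ 2 -> 0 <= Y -> 0 <= W ->
  e ^+ 2 <= (h ^+ 2 - k ^+ 2) * Y * W ->
  k * (Y - W) + 2 * e <= h * (Y + W).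
Proof.
move=> h0 kh Y0 W0 e2; set j := h ^+ 2 - k ^+ 2 in e2.
have j0 : 0 <= j by rewrite subr_ge0.
apply: (le_trans (ler_norm _)).
rewrite -[leRHS]ger0_norm ?mulr_ge0 ?addr_ge0 //.
rewrite -[leLHS]sqrtr_sqr -[leRHS]sqrtr_sqr ler_sqrt ?sqr_ge0 //.
have hE : h ^+ 2 = k ^+ 2 + j by rewrite /j; ring.
rewrite exprMn hE; set d := Y - W; pose f := 4 * (Y * W).
have f0 : 0 <= f by rewrite !mulr_ge0.
have -> : (Y + W) ^+ 2 = d ^+ 2 + f by rewrite /f /d; ring.
have ef : (2 * e) ^+ 2 <= j * f.
  rewrite -subr_ge0 [X in 0 <= X](_ : _ = 4 * (j * Y * W - e ^+ 2)).
    by rewrite mulr_ge0 // subr_ge0.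
  by rewrite /f; ring.
have X0 : 0 <= k ^+ 2 * f + j * d ^+ 2.
  by rewrite addr_ge0 // mulr_ge0 ?sqr_ge0.
have am : 2 * (k * d * (2 * e)) <= k ^+ 2 * f + j * d ^+ 2.
  apply: (le_trans (ler_norm _)).
  rewrite -[leRHS]ger0_norm //.
  rewrite -[leLHS]sqrtr_sqr -[leRHS]sqrtr_sqr ler_sqrt ?sqr_ge0 //.
  apply: (@le_trans _ _ (4 * (k * d) ^+ 2 * (j * f))).
    have -> : (2 * (k * d * (2 * e))) ^+ 2 = 4 * (k * d) ^+ 2 * (2 * e) ^+ 2
      by ring.
    by rewrite ler_wpM2l // mulr_ge0 ?sqr_ge0.
  rewrite -subr_ge0 [X in 0 <= X](_ : _ = (k ^+ 2 * f
    - j * d ^+ 2) ^+ 2) ?sqr_ge0 //.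
  by ring.
rewrite -subr_ge0 [X in 0 <= X](_ : _ = (j * f - (2 * e) ^+ 2)
   + (k ^+ 2 * f + j * d ^+ 2 - 2 * (k * d * (2 * e)))); last by ring.
by rewrite addr_ge0 // subr_ge0.
Qed.

(* The square of [[k, N], [N^*, -k]] is the direct sum of M = k^2 + N N^* and
   k^2 + N^* N, so its largest eigenvalue is the square root of that of M. *)
Section DirectionMax.
Context (R : realType) (k : R) (N : 'M[R[i]]_2).
Let M := (k ^+ 2)%:C%C%:M + N *m N ^t*.
Let value (y w : 'cV[R[i]]_2) := k * (rdot y y - rdot w w)
  + 2 * rdot y (N *m w).

Lemma rdot_direction (y : 'cV[R[i]]_2) :
  rdot (N ^t* *m y) (N ^t* *m y) = rdot y (M *m y) - k ^+ 2 * rdot y y.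
Proof.
by rewrite -rdot_adjoint mulmxA mulmxDl mul_scalar_mx rdotDr rdotZr addrC addKr.
Qed.

Lemma direction_max_ge0 : k ^+ 2 <= pauli0 M + pauli_norm M.
Proof.
have [y y0] := pauli_form_attained M (expr1n _ 2); rewrite mul1r => yE.
rewrite -(ler_pM2r y0) -yE -subr_ge0 -rdot_direction; exact: rdot_ge0.
Qed.

Lemma direction_le (y w : 'cV[R[i]]_2) :
  value y w <= Num.sqrt (pauli0 M + pauli_norm M) * (rdot y y + rdot w w).
Proof.
have k2 := direction_max_ge0.
have p0 : 0 <= pauli0 M + pauli_norm M by apply: le_trans k2; exact: sqr_ge0.
apply: direction_max_le; rewrite ?sqrtr_ge0 ?rdot_ge0 ?sqr_sqrtr //.
rewrite rdot_adjoint; apply: (le_trans (rdot_cauchy _ _)).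
rewrite ler_wpM2r ?rdot_ge0 // rdot_direction mulrBl lerD2r.
exact: pauli_form_le.
Qed.

(** If [y] is an eigenvector of [M] for [h ^+ 2], then [((h + k) y, N^* y)] is one of [[k, N],
    [N^*, -k]] for [h]. The equation between the forms suffices for the values, and [h] may have
    either sign. *)
Lemma direction_value (y : 'cV[R[i]]_2) (h : R) :
  rdot y (M *m y) = h ^+ 2 * rdot y y ->
  let x := (h + k)%:C%C *: y in let w := N ^t* *m y in
  rdot x x + rdot w w = 2 * h * (h + k) * rdot y y /\
  value x w = h * (2 * h * (h + k) * rdot y y).
Proof.
move=> yE x w; rewrite /value /x /w rdot_adjoint -!scalemxAr.
rewrite !(rdotZl, rdotZr) !rdot_direction yE; split; ring.
Qed.

Lemma direction_attained : exists y w : 'cV[R[i]]_2,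
  0 < rdot y y + rdot w w /\
  value y w = Num.sqrt (pauli0 M + pauli_norm M) * (rdot y y + rdot w w).
Proof.
have k2 := direction_max_ge0.
set h := Num.sqrt _.
have h2 : h ^+ 2 = pauli0 M + pauli_norm M.
  by rewrite sqr_sqrtr //; apply: le_trans k2; exact: sqr_ge0.
have h0 : 0 <= h by exact: sqrtr_ge0.
have kh : `|k| <= h by rewrite -sqrtr_sqr ler_wsqrtr.
(* For [h = - k] the vector of [direction_value] vanishes, but every [(0, w)] has value [h] times
   its squared norm. *)
have [hk|hk] := eqVneq (h + k) 0.
  exists 0, (\col_i (i == 0)%:R).
  rewrite /value rdot_adjoint mulmx0 /rdot !cdot2E !mxE /=.
  have -> : h = - k by apply/eqP; rewrite -addr_eq0 hk.
  by split; [lra|ring].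
have [y y0] := pauli_form_attained M (expr1n _ 2); rewrite mul1r -h2 => yE.
have [e1 e2] := direction_value yE.
exists ((h + k)%:C%C *: y), (N ^t* *m y); rewrite e1 e2; split => //.
have hk0 : 0 < h + k.
  rewrite lt0r hk -lerBlDr sub0r; apply: le_trans kh.
  by rewrite -normrN ler_norm.
rewrite !mulr_gt0 // lt0r h0 andbT; apply/eqP => hz; move: kh hk.
by rewrite hz normr_le0 add0r => ->.
Qed.

End DirectionMax.

(** * Gram matrices and the condition for two translates *)

Definition pauli_dot (R : realType) (M N : 'M[R[i]]_2) : R :=
  pauli1 M * pauli1 N + pauli2 M * pauli2 N + pauli3 M * pauli3 N.

(* With L = re_part C D and G = im_part C D, the square of
   s Re A + t Im A has s^2 gram11 + 2 s t gram12 + t^2 gram22 as its upper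
   left block. *)
Definition gram11 (R : realType) (alpha : R[i]) (C D : 'M[R[i]]_2) :=
  (complex.Re alpha ^+ 2)%:C%C%:M + re_part C D *m (re_part C D) ^t*.

Definition gram12 (R : realType) (alpha : R[i]) (C D : 'M[R[i]]_2) :=
  (complex.Re alpha * complex.Im alpha)%:C%C%:M
  + 2^-1 *: (re_part C D *m (im_part C D) ^t*
             + im_part C D *m (re_part C D) ^t*).

Definition gram22 (R : realType) (alpha : R[i]) (C D : 'M[R[i]]_2) :=
  (complex.Im alpha ^+ 2)%:C%C%:M + im_part C D *m (im_part C D) ^t*.

(** The identities p = l^2 + g and |u|^2 = 4 l^2 g with l = r s, coefficient by coefficient. The
    first line is the vanishing of u at (0, 1); the arguments of [posdef] are the coefficients of g;
    the three equations compare those of s^2 t^2, s^3 t and s^4. *)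
Definition gram_condition (R : realType) (P1 P2 P3 : 'M[R[i]]_2) (r : R) :
  Prop :=
  [/\ pauli1 P3 = 0, pauli2 P3 = 0 & pauli3 P3 = 0] /\
  [/\ posdef (pauli0 P1 - r ^+ 2) (pauli0 P2) (pauli0 P3),
      pauli_dot P2 P2 = r ^+ 2 * pauli0 P3,
      pauli_dot P1 P2 = 2 * r ^+ 2 * pauli0 P2
    & pauli_dot P1 P1 = 4 * r ^+ 2 * (pauli0 P1 - r ^+ 2)].

Lemma ReZ (R : realType) (x : R) (z : R[i]) :
  complex.Re (x%:C%C * z) = x * complex.Re z.
Proof. by case: z => u v /=; rewrite mul0r subr0. Qed.

Lemma ImZ (R : realType) (x : R) (z : R[i]) :
  complex.Im (x%:C%C * z) = x * complex.Im z.
Proof. by case: z => u v /=; rewrite mul0r addr0. Qed.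

Lemma dir_quotient (R : realType) (s t u v Y h : R) :
  Y != 0 -> s * u + t * v = h * Y -> dir s t (Complex (u / Y) (v / Y)) = h.
Proof. by move=> Y0 e; apply: (mulIf Y0); rewrite -e /dir /=; field. Qed.

Section PauliLinear.
Context (R : realType) (x y z : R) (P Q S : 'M[R[i]]_2).
Let T := x%:C%C *: P + y%:C%C *: Q + z%:C%C *: S.

Lemma pauli0_linear : pauli0 T = x * pauli0 P + y * pauli0 Q + z * pauli0 S.
Proof. by rewrite /pauli0 /T !mxE !raddfD /= !ReZ; field. Qed.

Lemma pauli1_linear : pauli1 T = x * pauli1 P + y * pauli1 Q + z * pauli1 S.
Proof. by rewrite /pauli1 /T !mxE !raddfD /= !ReZ; field. Qed.

Lemma pauli2_linear : pauli2 T = x * pauli2 P + y * pauli2 Q + z * pauli2 S.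
Proof. by rewrite /pauli2 /T !mxE !raddfD /= !ImZ; field. Qed.

Lemma pauli3_linear : pauli3 T = x * pauli3 P + y * pauli3 Q + z * pauli3 S.
Proof. by rewrite /pauli3 /T !mxE !raddfD /= !ReZ; field. Qed.

End PauliLinear.

Definition gram_radius (R : realType) (P1 P2 P3 : 'M[R[i]]_2) (s t : R) : R :=
  Num.sqrt (qform (pauli0 P1) (pauli0 P2) (pauli0 P3) s t
    + Num.sqrt (qform (pauli1 P1) (pauli1 P2) (pauli1 P3) s t ^+ 2
        + qform (pauli2 P1) (pauli2 P2) (pauli2 P3) s t ^+ 2
        + qform (pauli3 P1) (pauli3 P2) (pauli3 P3) s t ^+ 2)).

Section Gram.
Context (R : realType) (alpha : R[i]) (C D : 'M[R[i]]_2).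
Let A : 'M[R[i]]_(2 + 2) := block_mx alpha%:M C D (- alpha)%:M.
Let a := complex.Re alpha.
Let b := complex.Im alpha.
Let L := re_part C D.
Let G := im_part C D.
Let P1 := gram11 alpha C D.
Let P2 := gram12 alpha C D.
Let P3 := gram22 alpha C D.
Let k (s t : R) := s * a + t * b.
Let N (s t : R) := s%:C%C *: L + t%:C%C *: G.
Let M (s t : R) := (k s t ^+ 2)%:C%C%:M + N s t *m (N s t) ^t*.

Lemma gramE s t :
  M s t = (s ^+ 2)%:C%C *: P1 + (2 * (s * t))%:C%C *: P2 + (t ^+ 2)%:C%C *: P3.
Proof.
rewrite /M /N /P1 /P2 /P3 /gram11 /gram12 /gram22 -/L -/G -/a -/b /k.
move: (L) (G) => L' G'; apply/matrixP => i j.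
rewrite !(mulmx2E, mxE) !rmorphD !rmorphM /= !conjC_real.
case: (i == j); rewrite ?mulr1n ?mulr0n ?rmorphXn ?rmorphD ?rmorphM /=.
all: by rewrite rmorph1; field.
Qed.

Lemma pauli0_gram s t : pauli0 (M s t) = qform (pauli0 P1) (pauli0 P2)
  (pauli0 P3) s t.
Proof.
by rewrite gramE; move: (P1) (P2) (P3) => Q1 Q2 Q3;
  rewrite pauli0_linear /qform; ring.
Qed.

Lemma pauli1_gram s t : pauli1 (M s t) = qform (pauli1 P1) (pauli1 P2)
  (pauli1 P3) s t.
Proof.
by rewrite gramE; move: (P1) (P2) (P3) => Q1 Q2 Q3;
  rewrite pauli1_linear /qform; ring.
Qed.

Lemma pauli2_gram s t : pauli2 (M s t) = qform (pauli2 P1) (pauli2 P2)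
  (pauli2 P3) s t.
Proof.
by rewrite gramE; move: (P1) (P2) (P3) => Q1 Q2 Q3;
  rewrite pauli2_linear /qform; ring.
Qed.

Lemma pauli3_gram s t : pauli3 (M s t) = qform (pauli3 P1) (pauli3 P2)
  (pauli3 P3) s t.
Proof.
by rewrite gramE; move: (P1) (P2) (P3) => Q1 Q2 Q3;
  rewrite pauli3_linear /qform; ring.
Qed.

(** [M s t] is positive semidefinite, and [pauli0] is the mean of its two eigenvalues. *)
Lemma pauli0_gram_ge0 s t : 0 <= pauli0 (M s t).
Proof.
have h (e : R) : e ^+ 2 = 1 -> 0 <= pauli0 (M s t) + e * pauli_norm (M s t).
  move=> /(pauli_form_attained (M s t))[y y0 yE].
  rewrite -(pmulr_lge0 _ y0) -yE; have := rdot_direction (k s t) (N s t) y.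
  move/eqP; rewrite eq_sym subr_eq => /eqP ->.
  by rewrite addr_ge0 ?rdot_ge0 // mulr_ge0 ?sqr_ge0 ?rdot_ge0.
have := h 1 (expr1n _ _); have := h (-1); rewrite sqrrN expr1n => /(_ erefl);
  lra.
Qed.

Lemma gram_radiusE s t :
  gram_radius P1 P2 P3 s t = Num.sqrt (pauli0 (M s t) + pauli_norm (M s t)).
Proof.
rewrite /pauli_norm (pauli0_gram s t) (pauli1_gram s t) (pauli2_gram s t).
by rewrite (pauli3_gram s t).
Qed.

Lemma gram_qform_ge0 s t : 0 <= qform (pauli0 P1) (pauli0 P2) (pauli0 P3) s t.
Proof. by rewrite -(pauli0_gram s t); exact: pauli0_gram_ge0. Qed.

Lemma value_direction (y w : 'cV[R[i]]_2) s t :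
  s * (a * (rdot y y - rdot w w) + 2 * rdot y (L *m w))
  + t * (b * (rdot y y - rdot w w) + 2 * rdot y (G *m w)) =
  k s t * (rdot y y - rdot w w) + 2 * rdot y (N s t *m w).
Proof.
rewrite /N /k; move: (L) (G) (a) (b) => L' G' a' b'.
rewrite mulmxDl -!scalemxAl rdotDr !rdotZr.
move: (rdot y _) (rdot y _) (rdot y y) (rdot w w) => p q Y W; ring.
Qed.

Lemma numerical_range_dir_le (z : R[i]) s t :
  numerical_range A z -> dir s t z <= gram_radius P1 P2 P3 s t.
Proof.
move=> /block_rangeP[y [w [n0 [h1 h2]]]].
have np : 0 < rdot y y + rdot w w by rewrite lt0r n0 addr_ge0 ?rdot_ge0.
have -> : dir s t z = (s * (complex.Re z * (rdot y y + rdot w w))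
    + t * (complex.Im z * (rdot y y + rdot w w))) / (rdot y y + rdot w w).
  by rewrite /dir; field.
rewrite ler_pdivrMr // h1 h2 (value_direction y w s t) gram_radiusE.
exact: direction_le.
Qed.

Lemma numerical_range_dir_attained s t :
  exists2 z, numerical_range A z & dir s t z = gram_radius P1 P2 P3 s t.
Proof.
have [y [w [np e]]] := direction_attained (k s t) (N s t).
have n0 : rdot y y + rdot w w != 0 by rewrite gt_eqF.
rewrite gram_radiusE; have := value_direction y w s t; rewrite e.
set Y := rdot y y + rdot w w; set u := a * _ + _; set v := b * _ + _ => uv.
exists (Complex (u / Y) (v / Y)).
  by apply/block_rangeP; exists y, w; split=> //; split; exact: divfK.
exact: dir_quotient n0 uv.
Qed.

Lemma gram_necessary (E1 E2 : set R[i]) (a1 b1 d1 a2 b2 d2 r : R) (c2 : R[i]) :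
  posdef a1 b1 d1 -> posdef a2 b2 d2 -> 0 < r ->
  E1 = ell a1 b1 d1 r%:C%C -> E2 = ell a2 b2 d2 c2 ->
  ~ E1 `<=` convex_hull E2 -> numerical_range A = convex_hull (E1 `|` E2) ->
  gram_condition P1 P2 P3 r.
Proof.
move=> pd1 pd2 r0 E1E E2E nsub WE.
have main s t := support_identity gram_qform_ge0 numerical_range_dir_le
  numerical_range_dir_attained pd1 pd2 r0 E1E E2E nsub WE s t.
move: (P1) (P2) (P3) main => Q1 Q2 Q3 main.
(* Four directions determine the coefficients. At [(0, 1)] a sum of squares vanishes, hence so does
   each traceless Pauli coordinate of [Q3]. *)
have [p1 q1] := main 1 0; have [p3 q3] := main 0 1.
have [p2 q2] := main 1 1; have [_ q2'] := main 1 (-1).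
move: p1 p2 p3 q1 q2 q2' q3.
rewrite /gram_condition /pauli_dot /qform {main}.
move: (pauli0 Q1) (pauli0 Q2) (pauli0 Q3) => p1 p2 p3.
move: (pauli1 Q1) (pauli1 Q2) (pauli1 Q3) => x1 x2 x3.
move: (pauli2 Q1) (pauli2 Q2) (pauli2 Q3) => y1 y2 y3.
move: (pauli3 Q1) (pauli3 Q2) (pauli3 Q3) => z1 z2 z3.
move=> h1 h2 h3 q1 q2 q2' q3.
have a1E : a1 = p1 - r ^+ 2 by lra.
have d1E : d1 = p3 by lra.
have b1E : b1 = p2 by lra.
move: q3; rewrite expr0n /= !(mulr0, mul0r, add0r) expr1n !mulr1 => /eqP.
rewrite paddr_eq0 ?addr_ge0 ?sqr_ge0 // paddr_eq0 ?sqr_ge0 // !expf_eq0 /=.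
move=> /andP[/andP[/eqP x30 /eqP y30] /eqP z30].
rewrite x30 y30 z30 a1E d1E b1E in q1 q2 q2' pd1 *.
by split; split => //; lra.
Qed.

End Gram.

(** The condition gives |u| = 2 r |s| sqrt g, which makes p + |u| the square of r |s| + sqrt g. *)
Lemma gram_radius_eq (R : realType) (P1 P2 P3 : 'M[R[i]]_2) (r s t : R) :
  0 < r -> gram_condition P1 P2 P3 r ->
  gram_radius P1 P2 P3 s t =
  r * `|s| + Num.sqrt (qform (pauli0 P1 - r ^+ 2) (pauli0 P2) (pauli0 P3) s t).
Proof.
move=> r0; rewrite /gram_condition /gram_radius /pauli_dot.
move: (pauli0 P1) (pauli0 P2) (pauli0 P3) => p1 p2 p3.
move: (pauli1 P1) (pauli1 P2) (pauli1 P3) => x1 x2 x3.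
move: (pauli2 P1) (pauli2 P2) (pauli2 P3) => y1 y2 y3.
move: (pauli3 P1) (pauli3 P2) (pauli3 P3) => z1 z2 z3.
move=> [[-> -> ->] [pd e22 e12 e11]].
have g0 := qform_ge0 s t pd; set g := qform (p1 - _) _ _ _ _ in g0 *.
have -> : qform p1 p2 p3 s t = r ^+ 2 * s ^+ 2 + g by rewrite /g /qform; ring.
have -> : qform x1 x2 0 s t ^+ 2 + qform y1 y2 0 s t ^+ 2
  + qform z1 z2 0 s t ^+ 2
    = (2 * r * `|s| * Num.sqrt g) ^+ 2.
  rewrite !exprMn sqr_sqrtr // real_normK ?num_real //.
  transitivity (s ^+ 2 * (s ^+ 2 * (x1 * x1 + y1 * y1 + z1 * z1)
     + 4 * (s * t) * (x1 * x2 + y1 * y2 + z1 * z2)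
     + 4 * t ^+ 2 * (x2 * x2 + y2 * y2 + z2 * z2))).
    by rewrite /qform; ring.
  by rewrite e22 e12 e11 /g /qform; ring.
have rs0 : 0 <= r * `|s| by rewrite mulr_ge0 // ltW.
have q0 := sqrtr_ge0 g.
rewrite sqrtr_sqr ger0_norm; last by do 3!rewrite mulr_ge0 //; exact: ltW.
have -> : r ^+ 2 * s ^+ 2 + g + 2 * r * `|s| * Num.sqrt g =
  (r * `|s| + Num.sqrt g) ^+ 2.
  rewrite sqrrD sqr_sqrtr // exprMn real_normK ?num_real // -mulr_natl; ring.
by rewrite sqrtr_sqr ger0_norm // addr_ge0.
Qed.

Lemma pauli_scalar_form (R : realType) (M : 'M[R[i]]_2) (y : 'cV[R[i]]_2) :
  pauli1 M = 0 -> pauli2 M = 0 -> pauli3 M = 0 ->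
  rdot y (M *m y) = pauli0 M * rdot y y.
Proof. by move=> h1 h2 h3; rewrite pauli_form h1 h2 h3 !mul0r !addr0. Qed.

(** The two products in [gram12] are adjoint to each other, so their forms have the same real
    part. *)
Lemma gram12_form (R : realType) (alpha : R[i]) (C D : 'M[R[i]]_2)
    (y : 'cV[R[i]]_2) :
  rdot y (gram12 alpha C D *m y) =
  complex.Re alpha * complex.Im alpha * rdot y y
  + rdot y (re_part C D *m ((im_part C D) ^t* *m y)).
Proof.
rewrite /gram12; move: (re_part C D) (im_part C D) => L G.
have h : rdot y (G *m L ^t* *m y) = rdot y (L *m (G ^t* *m y)).
  rewrite -(mulmxA G); apply: (etrans (rdot_adjoint G y (L ^t* *m y))).
  apply: (etrans (rdotC (L ^t* *m y) (G ^t* *m y))).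
  exact: (esym (rdot_adjoint L y (G ^t* *m y))).
rewrite mulmxDl mul_scalar_mx rdotDr rdotZr; congr (_ + _).
have -> : (2^-1 : R[i]) = (2^-1)%:C%C by rewrite fmorphV rmorph_nat.
rewrite -(scalemxAl _ (L *m G ^t* + G *m L ^t*) y) rdotZr mulmxDl rdotDr.
rewrite [X in _ + X]h -(mulmxA L); by field.
Qed.

(* At the two directions +-i the maximal eigenvalue is double; the corners are
   the values at its eigenvectors ((h + Im alpha) y, G^* y), where
   h = f * sqrt (pauli0 P3) and y is an eigenvector of gram12. *)
Lemma numerical_range_corner (R : realType) (alpha : R[i])
    (C D : 'M[R[i]]_2) (r e f : R) :
  let P1 := gram11 alpha C D in
  let P2 := gram12 alpha C D in
  let P3 := gram22 alpha C D in
  0 < r -> gram_condition P1 P2 P3 r -> e ^+ 2 = 1 -> f ^+ 2 = 1 ->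
  numerical_range (block_mx alpha%:M C D (- alpha)%:M : 'M[R[i]]_(2 + 2))
    (Complex (e * r + f * pauli0 P2 / Num.sqrt (pauli0 P3))
             (f * Num.sqrt (pauli0 P3))).
Proof.
move=> P1 P2 P3 r0 [[u1 u2 u3] [[_ p30 _] e22 _ _]] e2 f2.
set q := Num.sqrt _; have q0 : 0 < q by rewrite sqrtr_gt0.
have q2 : q ^+ 2 = pauli0 P3 by rewrite sqr_sqrtr // ltW.
have [h hE] : exists h, h = f * q by eexists.
have h2 : h ^+ 2 = pauli0 P3 by rewrite hE exprMn f2 mul1r.
set b := complex.Im alpha; pose a := complex.Re alpha.
have P3y y : rdot y (((b ^+ 2)%:C%C%:M + im_part C D *m (im_part C D) ^t*)
  *m y) =
    h ^+ 2 * rdot y y by rewrite h2; exact: pauli_scalar_form.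
have n2 : pauli_norm P2 = r * q.
  rewrite /pauli_norm; have -> : pauli1 P2 ^+ 2 + pauli2 P2 ^+ 2
    + pauli3 P2 ^+ 2 = (r * q) ^+ 2.
    transitivity (pauli_dot P2 P2); first by rewrite /pauli_dot !expr2.
    by rewrite e22 exprMn q2.
  by rewrite sqrtr_sqr ger0_norm // mulr_ge0 // ltW.
(* Otherwise the adjoint of [im_part C D] would annihilate every vector and the form of [P2] would
   be scalar, against [pauli_norm P2 = r * q > 0]. *)
have hb : h + b != 0.
  apply/eqP => hb.
  have Gy (y : 'cV[R[i]]_2) : im_part C D ^t* *m y = 0.
    have := rdot_direction b (im_part C D) y; rewrite P3y -mulrBl subr_sqr hb.
    by rewrite mulr0 mul0r => /eqP; rewrite rdot_eq0 => /eqP.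
  have P2y (y : 'cV[R[i]]_2) : rdot y (P2 *m y) = a * b * rdot y y.
    have y0 : rdot y 0 = 0 by rewrite /rdot /cdot mulmx0 mxE.
    by rewrite gram12_form Gy mulmx0 y0 addr0.
  have [y y0] := pauli_form_attained P2 (expr1n _ 2).
  rewrite P2y => /(mulIf (lt0r_neq0 y0)) eq1.
  have [|z z0] := @pauli_form_attained _ P2 (-1); first by rewrite sqrrN expr1n.
  rewrite P2y => /(mulIf (lt0r_neq0 z0)) eq2.
  have : pauli_norm P2 = 0 by lra.
  by rewrite n2 => /eqP; rewrite mulf_eq0 !gt_eqF.
(* The eigenvalue of [P2] gets divided by [h], which carries the sign [f]; with the sign [e * f] the
   quotient contributes [e * r]. *)
have [|y y0 yE] := @pauli_form_attained _ P2 (e * f);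
  first by rewrite exprMn e2 f2 mulr1.
have [e1 e3] := direction_value (P3y y).
rewrite n2 gram12_form -/a -/b in yE.
have h0 : h != 0 by apply/eqP => hz; move: h2; rewrite hz expr0n /= => /eqP;
  rewrite eq_sym gt_eqF.
have y0' := lt0r_neq0 y0.
have := rdot_direction b (im_part C D) y; rewrite P3y -mulrBl => w2.
apply/block_rangeP; exists ((h + b)%:C%C *: y), (im_part C D ^t* *m y).
rewrite e1; split; last split.
- by rewrite !mulf_eq0 pnatr_eq0 (negbTE h0) (negbTE hb) (negbTE y0').
- rewrite w2 !(rdotZl, rdotZr) -/a.
  have -> : rdot y (re_part C D *m (im_part C D ^t* *m y)) =
     ((pauli0 P2 + e * f * (r * q)) - a * b) * rdot y y
       by rewrite mulrBl -yE addrC addKr.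
  rewrite /=; move: (rdot y y) y0' => Y Y0.
  have -> : e * r + f * pauli0 P2 / q = (pauli0 P2 + e * f * (r * q)) / h.
    have f0 : f != 0 by apply: contraNneq h0 => f0; rewrite hE f0 mul0r.
    apply: (mulIf h0); rewrite divfK // hE.
    transitivity (f ^+ 2 * pauli0 P2 + e * f * (r * q));
      last by rewrite f2 mul1r.
    by field; rewrite gt_eqF.
  by field.
- by rewrite /= -hE -/b -e3.
Qed.

Lemma gram_sufficient (R : realType) (alpha : R[i]) (C D : 'M[R[i]]_2) (r : R) :
  0 < r ->
  gram_condition (gram11 alpha C D) (gram12 alpha C D) (gram22 alpha C D) r ->
  bi_elliptical
    (numerical_range (block_mx alpha%:M C D (- alpha)%:M : 'M[R[i]]_(2 + 2))).
Proof.
move=> r0 gc; have [_ [pd _ _ _]] := gc.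
set A := block_mx _ _ _ _.
have := bi_elliptical_translates pd r0; set H := convex_hull _.
have -> // : numerical_range A = H.
apply: (stadium_eq pd r0).
- exact: numerical_range_cvx.
- move=> z s t Wz; rewrite -(gram_radius_eq s t r0 gc).
  exact: numerical_range_dir_le.
- move=> s t _; rewrite -(gram_radius_eq s t r0 gc).
  exact: numerical_range_dir_attained.
- by move=> e f; exact: numerical_range_corner.
Qed.

(** * The spectral conditions *)

Lemma det_mx2 (R : comPzRingType) (A : 'M[R]_2) :
  \det A = A 0 0 * A 1 1 - A 0 1 * A 1 0.
Proof.
rewrite (expand_det_row _ 0) !big_ord_recl big_ord0 /cofactor !det_mx11 !mxE /=.
rewrite /bump /= expr0 expr1 mul1r mulN1r mulrN addr0.
by congr (A _ _ * A _ _ - A _ _ * A _ _); apply/val_inj.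
Qed.

Lemma char_poly_mx2 (R : comNzRingType) (A : 'M[R]_2) (x : R) :
  (char_poly A).[x] = (x - A 0 0) * (x - A 1 1) - A 0 1 * A 1 0.
Proof.
rewrite /char_poly det_mx2 /char_poly_mx !mxE /= !mulr1n !mulr0n !sub0r.
by rewrite !(hornerD, hornerN, hornerM, hornerX, hornerC) mulrNN.
Qed.

(** Schur complement: a block triangular factor of determinant [b ^+ 2], where [b] is ['X + a%:P],
    clears the lower left block and is cancelled at the end. *)
Lemma char_poly_block (F : fieldType) (a : F) (C D : 'M[F]_2) :
  let T := (a ^+ 2)%:M + C *m D in
  char_poly (block_mx a%:M C D (- a)%:M : 'M[F]_(2 + 2)) =
  'X^4 - (T 0 0 + T 1 1)%:P * 'X^2 + (\det T)%:P.
Proof.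
move=> T; rewrite /char_poly /char_poly_mx.
have -> : 'X%:M - map_mx polyC (block_mx a%:M C D (- a)%:M : 'M[F]_(2 + 2)) =
    block_mx ('X - a%:P)%:M (- map_mx polyC C) (- map_mx polyC D) ('X
      + a%:P)%:M :> 'M_(2+2).
  rewrite map_block_mx !map_scalar_mx /= scalar_mx_block opp_block_mx
    add_block_mx.
  rewrite !add0r; congr block_mx; first by rewrite raddfB.
  by rewrite -raddfN -raddfD /= polyCN opprK.
set b : {poly F} := 'X + a%:P.
have b0 : b != 0 by rewrite -size_poly_eq0 size_XaddC.
have b20 : b ^+ 2 != 0 by rewrite expf_neq0.
apply: (mulIf b20).
have d1 : \det (block_mx b%:M 0 (map_mx polyC D) 1%:M : 'M_(2 + 2)) = b ^+ 2.
  by rewrite det_lblock det1 mulr1 det_scalar.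
rewrite -{1}d1 -det_mulmx mulmx_block !mulmx0 !mulmx1 !add0r.
have -> : - map_mx polyC D *m b%:M + b%:M *m map_mx polyC D = 0.
  by rewrite mul_mx_scalar mul_scalar_mx scalerN addNr.
rewrite det_ublock det_scalar; congr (_ * _).
rewrite mulNmx -scalar_mxM !det_mx2 /T !(mulmx2E, mxE) /= !mulr1n !mulr0n /b.
rewrite !(polyCD, polyCN, polyCM, polyC_exp, polyC0) !add0r.
by ring.
Qed.

Lemma mulmx_adjoint (R : realType) (m n p : nat) (M : 'M[R[i]]_(m, n))
    (N : 'M[R[i]]_(n, p)) :
  (M *m N) ^t* = N ^t* *m M ^t*.
Proof. by rewrite trmx_mul map_mxM. Qed.

(** The trace is the sum of the squared moduli of the entries. *)
Lemma mxtrace_adjoint_eq0 (R : realType) (m n : nat) (M : 'M[R[i]]_(m, n)) :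
  \tr (M *m M ^t*) = 0 -> M = 0.
Proof.
move=> tr0; have h i : (M *m M ^t*) i i = \sum_j `|M i j| ^+ 2.
  by rewrite mxE; apply: eq_bigr => j _; rewrite !mxE normCK.
have pos i : 0 <= \sum_j `|M i j| ^+ 2 by apply: sumr_ge0 => j _;
  exact: exprn_ge0.
move/eqP: tr0; rewrite /mxtrace (eq_bigr _ (fun i _ => h i)) psumr_eq0 //.
move=> /allP all0; apply/matrixP => i j; rewrite mxE.
have := all0 i (mem_index_enum i); rewrite /= psumr_eq0 => [|k _];
  last exact: exprn_ge0.
move=> /allP/(_ j (mem_index_enum j)); rewrite /= expf_eq0 /= normr_eq0.
by move/eqP.
Qed.

(* With E = Y Z - Z Y, the hypothesis says E Z = Y E; moving factors around
   under the trace then gives tr (E^2) = 0. *)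
Lemma mxtrace_commutator_sqr (F : comNzRingType) (n : nat) (Y Z : 'M[F]_n) :
  Y *m Z *m (Z + Y) = (Z + Y) *m (Y *m Z) ->
  \tr ((Y *m Z - Z *m Y) *m (Y *m Z - Z *m Y)) = 0.
Proof.
move=> h; pose w (A B C D : 'M[F]_n) := \tr (A *m B *m (C *m D)).
have cyc A B C D : w A B C D = w B C D A.
  by rewrite /w -mulmxA mxtrace_mulC !mulmxA.
have h1 : \tr (Y *m Z *m (Z + Y) *m Y) = \tr ((Z + Y) *m (Y *m Z) *m Y)
  by rewrite h.
have {h1} : w Y Z Z Y + w Y Z Y Y = w Z Y Z Y + w Y Y Z Y.
  move: h1; rewrite mulmxDr mulmxDl [in RHS]mulmxDl [in RHS]mulmxDl !mxtraceD.
  rewrite -(mulmxA (Y *m Z) Z) -(mulmxA (Y *m Z) Y).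
  rewrite (mulmxA Z Y Z) (mulmxA Y Y Z).
  by rewrite -(mulmxA (Z *m Y) Z) -(mulmxA (Y *m Y) Z).
rewrite -(cyc Y Y Z Y) => /addIr e.
rewrite mulmxBl !mulmxBr !(raddfB (@mxtrace F n)) /= -/(w Y Z Y Z)
  -/(w Y Z Z Y) -/(w Z Y Y Z) -/(w Z Y Z Y).
by rewrite (cyc Y Z Y Z) -e (cyc Z Y Y Z) (cyc Y Y Z Z) !subrr.
Qed.

(** The commutator [E] is Hermitian, so the trace of its square is that of [E *m E ^t*]; as it
    vanishes, [E = 0]. *)
Lemma normal_of_commuting_real_part (R : realType) (n : nat) (Z : 'M[R[i]]_n) :
  Z ^t* *m Z *m (Z + Z ^t*) = (Z + Z ^t*) *m (Z ^t* *m Z) ->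
  Z *m Z ^t* = Z ^t* *m Z.
Proof.
move/mxtrace_commutator_sqr; set E := _ - _ => tr0.
have EE : E ^t* = E.
  by rewrite /E linearB /= map_mxB !mulmx_adjoint !trmxCK.
have E0 : E = 0 by apply: mxtrace_adjoint_eq0; rewrite EE.
exact: (esym (subr0_eq E0)).
Qed.

Lemma hermitian_pauli (R : realType) (M : 'M[R[i]]_2) : M ^t* = M ->
  [/\ M 0 0 = (pauli0 M + pauli3 M)%:C%C, M 1 1 = (pauli0 M - pauli3 M)%:C%C,
      M 0 1 = Complex (pauli1 M) (- pauli2 M) & M 1 0 =
        Complex (pauli1 M) (pauli2 M)].
Proof.
move=> MM; have h i j : Num.conj (M j i) = M i j by rewrite -[in RHS]MM !mxE.
move: (h 0 0) (h 0 1) (h 1 1); rewrite /pauli0 /pauli1 /pauli2 /pauli3.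
case: (M 0 0) (M 0 1) (M 1 0) (M 1 1) => [a b] [c d] [e f] [g k] /=.
move=> [b0] [<- <-] [k0]; have {}b0 : b = 0 by lra.
have {}k0 : k = 0 by lra.
by rewrite b0 k0; split; apply/eqP; rewrite eq_complex /=; apply/andP; split;
  apply/eqP; field.
Qed.

(** The commutator is, up to a factor, the traceless matrix of the cross product of the two Pauli
    vectors. *)
Lemma pauli_commute (R : realType) (M N : 'M[R[i]]_2) :
  M ^t* = M -> N ^t* = N ->
  M *m N = N *m M <->
  [/\ pauli1 M * pauli2 N = pauli2 M * pauli1 N,
      pauli2 M * pauli3 N = pauli3 M * pauli2 N
    & pauli1 M * pauli3 N = pauli3 M * pauli1 N].
Proof.
move=> /hermitian_pauli[m00 m11 m01 m10] /hermitian_pauli[n00 n11 n01 n10].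
move: (pauli0 M) (pauli1 M) (pauli2 M) (pauli3 M) m00 m11 m01 m10 => p x y z.
move: (pauli0 N) (pauli1 N) (pauli2 N) (pauli3 N) n00 n11 n01 n10 => q u v w.
move=> n00 n11 n01 n10 m00 m11 m01 m10.
split=> [e|[e1 e2 e3]].
  have := congr1 (fun X : 'M_2
    => X 0 0) e; rewrite /= !mulmx2E m00 m01 m10 n00 n01 n10.
  move/eqP; rewrite eq_complex /= => /andP[/eqP h1 /eqP h2].
  have := congr1 (fun X : 'M_2
    => X 0 1) e; rewrite /= !mulmx2E m00 m01 m11 n00 n01 n11.
  move/eqP; rewrite eq_complex /= => /andP[/eqP h3 /eqP h4].
  by split; lra.
apply/matrixP => i j; rewrite !mulmx2E.
by case: (ord2P i) => ->; case: (ord2P j) => ->;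
  rewrite ?m00 ?m01 ?m10 ?m11 ?n00 ?n01 ?n10 ?n11; apply/eqP;
  rewrite eq_complex /=; apply/andP; split; apply/eqP; lra.
Qed.

Lemma comm_mx_affine (F : fieldType) (n : nat) (x y c d : F) (M N : 'M[F]_n) :
  c != 0 -> d != 0 ->
  comm_mx (x%:M + c *: M) (y%:M + d *: N) <-> comm_mx M N.
Proof.
have right (z e : F) (A B : 'M[F]_n) : comm_mx A B -> comm_mx A (z%:M + e *: B).
  move=> AB; rewrite -mul_scalar_mx; apply: comm_mxD;
    first exact: comm_mx_scalar.
  by apply: comm_mxM => //; exact: comm_mx_scalar.
have both (z e z' e' : F) (A B : 'M[F]_n) :
    comm_mx A B -> comm_mx (z%:M + e *: A) (z'%:M + e' *: B).
  by move=> AB; apply/right/comm_mx_sym/right/comm_mx_sym.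
move=> c0 d0; split; last exact: both.
have inv (z e : F) (A : 'M[F]_n) : e != 0 ->
    A = (- (e^-1 * z))%:M + e^-1 *: (z%:M + e *: A).
  move=> e0; rewrite scalerDr scalerA mulVf // scale1r scale_scalar_mx addrA.
  by rewrite -raddfD addNr raddf0 add0r.
by move=> /(both (- (c^-1 * x)) c^-1 (- (d^-1 * y)) d^-1); rewrite -!inv.
Qed.

Lemma adjoint_affine (R : realType) (n : nat) (x c : R[i]) (M : 'M[R[i]]_n) :
  (x%:M + c *: M) ^t* = (Num.conj x)%:M + Num.conj c *: M ^t*.
Proof. by rewrite linearD linearZ /= tr_scalar_mx map_mxD map_mxZ
  map_scalar_mx. Qed.

Lemma twoCi_neq0 (R : realType) : (2 * 'i : R[i]) != 0.
Proof. by rewrite mulf_neq0 ?pnatr_eq0 // neq0Ci. Qed.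

Lemma mulmx_scalarC (F : fieldType) (n : nat) (c : F) (M N : 'M[F]_n) :
  c != 0 -> M *m N = c%:M -> N *m M = c%:M.
Proof.
move=> c0 MN; have : (c^-1 *: M) *m N = 1%:M.
  by rewrite -scalemxAl MN scale_scalar_mx mulVf.
move/mulmx1C; rewrite -scalemxAr => h.
by rewrite -[LHS]scale1r -(mulfV c0) -scalerA h scale_scalar_mx mulr1.
Qed.

(* With Z = G L^*, the hypothesis gives Z^* Z = rho L L^*. *)
Lemma normal_iff_gram_commute (R : realType) (a b rho : R) (L G : 'M[R[i]]_2) :
  G *m G ^t* = (rho%:C%C)%:M ->
  ((2 * 'i) *: G *m (L ^t* + 'i *: G ^t*) \is normalmx) <->
  comm_mx ((a ^+ 2)%:C%C%:M + L *m L ^t*)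
          ((a * b)%:C%C%:M + 2^-1 *: (L *m G ^t* + G *m L ^t*)).
Proof.
move=> GG; pose Z := G *m L ^t*.
have i0 := twoCi_neq0 R.
have Za : Z ^t* = L *m G ^t* by rewrite mulmx_adjoint trmxCK.
have XD : (2 * 'i) *: G *m (L ^t* + 'i *: G ^t*) =
    (- (2 * rho%:C%C))%:M + (2 * 'i) *: Z.
  rewrite mulmxDr -scalemxAl -scalemxAr -!scalemxAl GG scalerA mulrCA mulrA.
  rewrite -/Z addrC scale_scalar_mx; congr (_%:M + _).
  transitivity (2 * ('i * 'i) * rho%:C%C); last by rewrite mulCii; ring.
  by ring.
have N1 : ((2 * 'i) *: G *m (L ^t* + 'i *: G ^t*) \is normalmx)
  <-> comm_mx Z (Z ^t*).
  rewrite XD; split.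
    by move/normalmxP; rewrite adjoint_affine => /comm_mx_affine; apply;
      rewrite ?conjC_eq0.
  by move=> ZZ; apply/normalmxP; rewrite adjoint_affine; apply/comm_mx_affine;
    rewrite ?conjC_eq0.
rewrite N1 -Za -/Z {N1 XD}.
have N2 : comm_mx ((a ^+ 2)%:C%C%:M + L *m L ^t*)
    ((a * b)%:C%C%:M + 2^-1 *: (Z ^t* + Z)) <-> comm_mx (L *m L ^t*) (Z ^t* +
      Z).
  rewrite -[X in comm_mx (_ + X)]scale1r.
  by apply: comm_mx_affine; rewrite ?oner_neq0 // invr_eq0 pnatr_eq0.
rewrite N2 {N2}.
(* For [rho = 0] the matrix [G] vanishes, and both commutations are trivial. *)
have [rho0|rho0] := eqVneq rho 0.
  have G0 : G = 0 by apply: mxtrace_adjoint_eq0;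
    rewrite GG rho0 rmorph0 mxtrace0.
  have Z0 : Z = 0 by rewrite /Z G0 mul0mx.
  by rewrite Z0 linear0 map_mx0 addr0; split=> _; exact: comm_mx0.
have rc0 : (rho%:C%C : R[i]) != 0 by rewrite realC_eq0.
have GG' := mulmx_scalarC rc0 GG.
have ZZ : Z ^t* *m Z = rho%:C%C *: (L *m L ^t*).
  by rewrite Za /Z mulmxA -(mulmxA L) GG' -mulmxA mul_scalar_mx scalemxAr.
have N3 : comm_mx (L *m L ^t*) (Z ^t* + Z) <-> comm_mx (Z ^t* *m Z) (Z + Z ^t*).
  have s0 : (0 : R[i])%:M = 0 :> 'M_2 by apply/matrixP => i j;
    rewrite !mxE mul0rn.
  have := @comm_mx_affine _ _ 0 0 (rho%:C%C) 1 (L *m L ^t*) (Z ^t* + Z) rc0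
    (oner_neq0 _).
  by rewrite s0 !add0r scale1r -ZZ [Z + _]addrC => ->.
rewrite N3; split=> [ZC|/normal_of_commuting_real_part //].
apply: comm_mxD.
  by apply: comm_mx_sym; apply: comm_mxM => //; exact: comm_mx_refl.
apply: comm_mx_sym; apply: comm_mxM; first exact: comm_mx_refl.
exact: comm_mx_sym.
Qed.

Lemma lower_re_im_part (R : realType) (n : nat) (C D : 'M[R[i]]_n) :
  D = (re_part C D) ^t* + 'i *: (im_part C D) ^t*.
Proof.
have [_] := re_im_part C D; move: (re_part C D) (im_part C D) => L G DE.
apply/matrixP => j k; have := congr1 (fun M : 'M_n => Num.conj (M k j)) DE.
rewrite !mxE /= conjCK => ->.
by rewrite (rmorphB Num.conj) (rmorphM Num.conj) /= conjCi mulNr opprK.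
Qed.

Lemma complex_rect (R : realType) (z : R[i]) :
  z = (complex.Re z)%:C%C + 'i * (complex.Im z)%:C%C.
Proof. exact: complexE. Qed.

Lemma gram_product (R : realType) (alpha : R[i]) (C D : 'M[R[i]]_2) :
  (alpha ^+ 2)%:M + C *m D =
  gram11 alpha C D - gram22 alpha C D + (2 * 'i) *: gram12 alpha C D.
Proof.
suff main (a b : R) (L G : 'M[R[i]]_2) :
    ((a%:C%C + 'i * b%:C%C) ^+ 2)%:M + (L + 'i *: G) *m (L ^t* + 'i *: G ^t*) =
    (a ^+ 2)%:C%C%:M + L *m L ^t* - ((b ^+ 2)%:C%C%:M + G *m G ^t*)
    + (2 * 'i) *: ((a * b)%:C%C%:M + 2^-1 *: (L *m G ^t* + G *m L ^t*)).
  have := main (complex.Re alpha) (complex.Im alpha) (re_part C D)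
    (im_part C D).
  by rewrite -complex_rect -(proj1 (re_im_part C D)) -(lower_re_im_part C D).
rewrite mulmxDl !mulmxDr -!scalemxAl -!scalemxAr scalerA mulCii.
move: (L *m L ^t*) (L *m G ^t*) (G *m L ^t*) (G *m G ^t*) => X Y Z W.
have i2 : 'i ^+ 2 = -1 :> R[i] by rewrite expr2 mulCii.
apply/matrixP => j k; rewrite !mxE.
rewrite sqrrD exprMn i2 !(rmorphXn, rmorphM) /=.
by case: (j == k); rewrite ?mulr1n ?mulr0n; field.
Qed.

Lemma gram11_adjoint (R : realType) (alpha : R[i]) (C D : 'M[R[i]]_2) :
  (gram11 alpha C D) ^t* = gram11 alpha C D.
Proof.
rewrite /gram11; move: (re_part C D) => L.
rewrite linearD /= map_mxD tr_scalar_mx map_scalar_mx /= conjC_real.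
by rewrite mulmx_adjoint trmxCK.
Qed.

Lemma gram22_adjoint (R : realType) (alpha : R[i]) (C D : 'M[R[i]]_2) :
  (gram22 alpha C D) ^t* = gram22 alpha C D.
Proof.
rewrite /gram22; move: (im_part C D) => L.
rewrite linearD /= map_mxD tr_scalar_mx map_scalar_mx /= conjC_real.
by rewrite mulmx_adjoint trmxCK.
Qed.

Lemma gram12_adjoint (R : realType) (alpha : R[i]) (C D : 'M[R[i]]_2) :
  (gram12 alpha C D) ^t* = gram12 alpha C D.
Proof.
rewrite /gram12; move: (re_part C D) (im_part C D) => L G.
rewrite adjoint_affine conjC_real linearD /= map_mxD !mulmx_adjoint !trmxCK.
have -> : Num.conj (2^-1 : R[i]) = 2^-1 by rewrite fmorphV rmorph_nat.
by rewrite [G *m _ + _]addrC.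
Qed.

Lemma im_part_adjoint (R : realType) (n : nat) (C D : 'M[R[i]]_n) :
  (2 * 'i)^-1 *: (D - C ^t*) = (im_part C D) ^t*.
Proof.
have [CE _] := re_im_part C D; rewrite {1}CE {1}(lower_re_im_part C D) {CE}.
move: (re_part C D) (im_part C D) => L G.
have i0 : 'i != 0 :> R[i] by rewrite neq0Ci.
apply/matrixP => j k; rewrite !mxE (rmorphD Num.conj) (rmorphM Num.conj) /=
  conjCi.
by field.
Qed.

Lemma im_mx_block (R : realType) (n : nat) (alpha : R[i]) (C D : 'M[R[i]]_n) :
  im_mx (block_mx alpha%:M C D (- alpha)%:M : 'M[R[i]]_(n + n)) =
  block_mx (complex.Im alpha)%:C%C%:M (im_part C D) ((im_part C D) ^t*)
           (- (complex.Im alpha)%:C%C)%:M.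
Proof.
have bE : (2 * 'i)^-1 * (alpha - Num.conj alpha) = (complex.Im alpha)%:C%C.
  have i0 : 'i != 0 :> R[i] by rewrite neq0Ci.
  have ai : Num.conj alpha = (complex.Re alpha)%:C%C
    - 'i * (complex.Im alpha)%:C%C.
    by rewrite [alpha in LHS]complex_rect rmorphD rmorphM /= !conjC_real conjCi
      mulNr.
  by rewrite ai {1}(complex_rect alpha); field.
rewrite /im_mx tr_block_mx map_block_mx opp_block_mx add_block_mx
  scale_block_mx.
rewrite (im_part_adjoint C D) !tr_scalar_mx !map_scalar_mx /=
  -!raddfB !scale_scalar_mx.
have bN : (2 * 'i)^-1 * (- alpha - Num.conj (- alpha)) =
  - (complex.Im alpha)%:C%C.
  by rewrite (rmorphN Num.conj) /= -opprD mulrN bE.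
by congr (block_mx _%:M _ _ _%:M); [exact: bE|exact: bN].
Qed.

(** Im A has the same block form, so its determinant is the constant term of [char_poly_block]; the
    sign is trivial in dimension 4. *)
Lemma det_im_mx_block (R : realType) (alpha : R[i]) (C D : 'M[R[i]]_2) :
  \det (im_mx (block_mx alpha%:M C D (- alpha)%:M : 'M[R[i]]_(2 + 2))) =
  \det (gram22 alpha C D).
Proof.
rewrite im_mx_block; set M := block_mx _ _ _ _.
have := char_poly_det M; rewrite -signr_odd /= expr0 mul1r => <-.
rewrite /M char_poly_block coefD coefB coefXn coefCM coefXn coefC /= mulr0
  subrr add0r.
by rewrite -(rmorphXn (real_complex R)).
Qed.

Lemma eigenvalue_mx2 (F : fieldType) (M : 'M[F]_2) (s : F) :
  eigenvalue M s <-> (s - M 0 0) * (s - M 1 1) = M 0 1 * M 1 0.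
Proof.
rewrite eigenvalue_root_char /root char_poly_mx2 subr_eq0.
by split=> [/eqP|/eqP].
Qed.

(** The three gram matrices are Hermitian, so only the term of [gram_product] with the factor
    [2 * 'i] contributes. *)
Lemma im_gram_product (R : realType) (alpha : R[i]) (C D : 'M[R[i]]_2) :
  im_mx ((alpha ^+ 2)%:M + C *m D) = 2 *: gram12 alpha C D.
Proof.
rewrite gram_product /im_mx.
move: (gram11_adjoint alpha C D) (gram12_adjoint alpha C D) (gram22_adjoint
  alpha C D).
move: (gram11 alpha C D) (gram12 alpha C D) (gram22 alpha C D)
  => P Q S hP hQ hS.
have i0 : 'i != 0 :> R[i] by rewrite neq0Ci.
have h (M : 'M[R[i]]_2) i j : M ^t* = M -> Num.conj (M j i) = M i j.
  by move=> MM; rewrite -[in RHS]MM !mxE.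
apply/matrixP => j k; rewrite !mxE (rmorphD Num.conj) (rmorphB Num.conj)
  !(rmorphM Num.conj) /=.
by rewrite !h // conjCi rmorph_nat; field.
Qed.

(** Exchanging [C] and [D] turns the first diagonal block of A^2 into the second. *)
Lemma parts_swap (R : realType) (n : nat) (C D : 'M[R[i]]_n) :
  re_part D C = (re_part C D) ^t* /\ im_part D C = (im_part C D) ^t*.
Proof.
split; last exact: im_part_adjoint.
apply/matrixP => j k; rewrite !mxE (rmorphM Num.conj) (rmorphD Num.conj) /=
  conjCK.
by rewrite fmorphV rmorph_nat addrC.
Qed.

Lemma eigenvalue_block_diag (F : fieldType) (n1 n2 : nat) (M : 'M[F]_n1)
    (N : 'M[F]_n2) (s : F) :
  eigenvalue (block_mx M 0 0 N) s <-> eigenvalue M s \/ eigenvalue N s.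
Proof.
split=> [/eigenvalueP[v]|[/eigenvalueP[v vM v0]|/eigenvalueP[v vN v0]]].
- rewrite -[v]hsubmxK; set v1 := lsubmx v; set v2 := rsubmx v.
  rewrite mul_row_block !mulmx0 add0r addr0 scale_row_mx
    => /eq_row_mx[h1 h2] v0.
  have [v10|v10] := eqVneq v1 0; last by left; apply/eigenvalueP; exists v1.
  right; apply/eigenvalueP; exists v2 => //; apply: contraNneq v0 => v20.
  by rewrite v10 v20 row_mx0.
- apply/eigenvalueP; exists (row_mx v 0).
    by rewrite mul_row_block !mulmx0 !mul0mx !addr0 scale_row_mx scaler0 vM.
  by apply: contraNneq v0 => /(congr1 lsubmx); rewrite row_mxKl linear0 => ->.
- apply/eigenvalueP; exists (row_mx 0 v).
    by rewrite mul_row_block !mulmx0 !mul0mx !add0r scale_row_mx scaler0 vN.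
  by apply: contraNneq v0 => /(congr1 rsubmx); rewrite row_mxKr linear0 => ->.
Qed.

(* G intertwines the two diagonal blocks of Im (A^2). *)
Lemma eigenvalue_swap (R : realType) (a b rho : R) (L G : 'M[R[i]]_2)
    (s : R[i]) :
  G *m G ^t* = (rho%:C%C)%:M ->
  let P (U V : 'M[R[i]]_2) := 2 *: ((a * b)%:C%C%:M + 2^-1 *:
    (U *m V ^t* + V *m U ^t*)) in
  eigenvalue (P (L ^t*) (G ^t*)) s -> eigenvalue (P L G) s.
Proof.
move=> GG P; have [rho0|rho0] := eqVneq rho 0.
  have -> : G = 0 by apply: mxtrace_adjoint_eq0;
    rewrite GG rho0 rmorph0 mxtrace0.
  by rewrite /P linear0 map_mx0 linear0 map_mx0 !(mulmx0, mul0mx).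
have rc0 : (rho%:C%C : R[i]) != 0 by rewrite realC_eq0.
have GG' := mulmx_scalarC rc0 GG.
have GP : G *m P (L ^t*) (G ^t*) = P L G *m G.
  rewrite /P !trmxCK -scalemxAr -scalemxAl mulmxDr mulmxDl -scalemxAr
    -scalemxAl.
  rewrite mulmxDr mulmxDl [G *m (L ^t* *m G)]mulmxA (mulmxA G (G ^t*)) GG.
  rewrite -(mulmxA L (G ^t*)) GG' !mul_mx_scalar !mul_scalar_mx.
  by congr (_ *: (_ + _ *: _)); exact: addrC.
move=> /eigenvalueP[v vP v0]; apply/eigenvalueP; exists (v *m G ^t*).
  have h : v *m G ^t* *m P L G *m G = (s *: (v *m G ^t*)) *m G.
    rewrite -mulmxA -GP -scalemxAl -(mulmxA v) (mulmxA (G ^t*)) GG'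
      -(mulmxA v) GG'.
    by rewrite mul_scalar_mx mul_mx_scalar -scalemxAr vP !scalerA mulrC.
  have := congr1 (mulmx^~ (G ^t*)) h.
  rewrite /= -(mulmxA (v *m G ^t* *m P L G)) GG -(mulmxA (s *:
    (v *m G ^t*))) GG.
  by rewrite !mul_mx_scalar => /(scalerI rc0).
apply: contraNneq v0 => h; have : v *m G ^t* *m G = 0 by rewrite h mul0mx.
rewrite -mulmxA GG' mul_mx_scalar => /eqP.
by rewrite scaler_eq0 (negbTE rc0).
Qed.

Lemma scalar_multiple_of_unitaryP (R : realType) (n : nat) (X : 'M[R[i]]_n) :
  scalar_multiple_of_unitary X <-> exists k : R, X *m X ^t* = (k%:C%C)%:M.
Proof.
split=> [[c [U [/unitarymxP UU ->]]]|[k XX]].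
  exists (complex.Re (c * Num.conj c)).
  rewrite linearZ /= map_mxZ -scalemxAl -scalemxAr UU scalerA scale_scalar_mx
    mulr1.
  by congr _%:M; apply/esym/RRe_real/ger0_real; exact: mul_conjC_ge0.
(* A zero [k] forces [X = 0], and any unitary matrix serves. *)
have [k0|k0] := eqVneq k 0.
  exists 0, 1%:M; split.
    by apply/unitarymxP; rewrite tr_scalar_mx map_mx1 mul1mx.
  rewrite scale0r; apply: mxtrace_adjoint_eq0; rewrite XX k0.
  by rewrite mxtrace_scalar mul0rn.
(* In dimension 0 the equation says nothing about [k]; otherwise a diagonal entry shows that [k] is
   nonnegative. *)
have [n0|n0] := posnP n.
  by move: X XX; rewrite n0 => X _; exists 0, 1%:M; split; [apply/unitarymxP|];
    apply/matrixP => -[].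
have kc0 : (0 : R[i]) <= k%:C%C.
  have := congr1 (fun M : 'M_n => M (Ordinal n0) (Ordinal n0)) XX.
  rewrite /= !mxE eqxx mulr1n => <-; apply: sumr_ge0 => j _.
  by rewrite !mxE mul_conjC_ge0.
have c0 : sqrtC (k%:C%C : R[i]) != 0.
  by rewrite sqrtC_eq0 realC_eq0.
pose c : R[i] := sqrtC k%:C%C; have cc : Num.conj c = c.
  by apply/CrealP/ger0_real; rewrite sqrtC_ge0.
exists c, (c^-1 *: X); split; last by rewrite scalerA mulfV // scale1r.
apply/unitarymxP; rewrite linearZ /= map_mxZ fmorphV /= cc.
rewrite -scalemxAl -scalemxAr XX scalerA scale_scalar_mx.
have -> : (k%:C%C : R[i]) = c * c by rewrite -expr2 sqrtCK.
by congr _%:M; rewrite mulrACA mulVf // mulr1.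
Qed.

Lemma pauli_scalarP (R : realType) (b : R) (G : 'M[R[i]]_2) :
  let P := (b ^+ 2)%:C%C%:M + G *m G ^t* in
  (exists k : R, G *m G ^t* = (k%:C%C)%:M) <->
  [/\ pauli1 P = 0, pauli2 P = 0 & pauli3 P = 0].
Proof.
move=> P; split=> [[k GG]|[u1 u2 u3]].
  rewrite /pauli1 /pauli2 /pauli3 /P GG !mxE /= ?mulr1n ?mulr0n.
  by split; rewrite !(add0r, addr0, subrr) ?mul0r.
have PP : P ^t* = P.
  by rewrite linearD /= map_mxD tr_scalar_mx map_scalar_mx /= conjC_real
    mulmx_adjoint trmxCK.
have [p00 p11 p01 p10] := hermitian_pauli PP.
exists (pauli0 P - b ^+ 2); have -> : G *m G ^t* = P - (b ^+ 2)%:C%C%:M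
  by rewrite addrC addKr.
rewrite rmorphB raddfB /=; congr (_ - _); apply/matrixP => j k;
  rewrite [RHS]mxE.
by case: (ord2P j) => ->; case: (ord2P k) => ->;
  rewrite ?p00 ?p11 ?p01 ?p10 ?u1 ?u2 ?u3 /= ?addr0 ?subr0 ?oppr0.
Qed.

Lemma im_mx_block_diag (R : realType) (n1 n2 : nat) (M : 'M[R[i]]_n1)
    (N : 'M[R[i]]_n2) :
  im_mx (block_mx M 0 0 N) = block_mx (im_mx M) 0 0 (im_mx N).
Proof.
rewrite /im_mx tr_block_mx map_block_mx opp_block_mx add_block_mx
  scale_block_mx.
by rewrite !linear0 !map_mx0 !subr0 !scaler0.
Qed.

(** The eigenvalues are [2 * pauli0 P] plus and minus twice the length of the Pauli vector; the
    squared form avoids a choice of sign. *)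
Lemma eigenvalue_hermitian (R : realType) (P : 'M[R[i]]_2) (s : R[i]) :
  P ^t* = P ->
  eigenvalue (2 *: P) s <-> (s - (2 * pauli0 P)%:C%C) ^+ 2 =
    (4 * pauli_dot P P)%:C%C.
Proof.
move=> PP; rewrite eigenvalue_mx2 !mxE.
have [-> -> -> ->] := hermitian_pauli PP; rewrite /pauli_dot {PP}.
move: (pauli0 P) (pauli1 P) (pauli2 P) (pauli3 P) => p x y z.
have c2 : (2 : R[i]) = (2 : R)%:C%C by rewrite rmorph_nat.
have e1 : 2 * Complex x (- y) * (2 * Complex x y) = (4 * (x * x + y * y))%:C%C.
  by rewrite c2; apply/eqP; rewrite eq_complex /=; apply/andP; split;
    apply/eqP; ring.
have e2 : (s - 2 * (p + z)%:C%C) * (s - 2 * (p - z)%:C%C) =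
    (s - (2 * p)%:C%C) ^+ 2 - (4 * (z * z))%:C%C.
  rewrite c2 expr2; case: (s) => u v; apply/eqP; rewrite eq_complex /=.
  by apply/andP; split; apply/eqP; ring.
have e3 : (4 * (x * x + y * y + z * z))%:C%C =
  (4 * (x * x + y * y))%:C%C + (4 * (z * z))%:C%C :> R[i].
  by rewrite -rmorphD -mulrDr.
rewrite e1 e2 e3; split=> [<-|->]; first by rewrite subrK.
by rewrite addrK.
Qed.
Section Conditions.
Context (R : realType) (alpha : R[i]) (C D : 'M[R[i]]_2).
Let B : 'M[R[i]]_(2 + 2) := block_mx alpha%:M C D (- alpha)%:M.
Let P1 := gram11 alpha C D.
Let P2 := gram12 alpha C D.
Let P3 := gram22 alpha C D.
Let scalar3 := [/\ pauli1 P3 = 0, pauli2 P3 = 0 & pauli3 P3 = 0].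

Lemma gram22_scalar : scalar3 <->
  exists k : R, im_part C D *m (im_part C D) ^t* = (k%:C%C)%:M.
Proof. exact: iff_sym (pauli_scalarP _ _). Qed.

Lemma unitary_gram22 : scalar_multiple_of_unitary (C - D ^t*) <-> scalar3.
Proof.
rewrite gram22_scalar scalar_multiple_of_unitaryP.
have XE : C - D ^t* = (2 * 'i) *: im_part C D.
  by rewrite /im_part scalerA mulfV ?scale1r // twoCi_neq0.
rewrite XE; move: (im_part C D) => G.
have XX : ((2 * 'i) *: G) *m ((2 * 'i) *: G) ^t* = 4 *: (G *m G ^t*).
  rewrite linearZ /= map_mxZ -scalemxAl -scalemxAr scalerA rmorphM /= conjCi
    rmorph_nat.
  congr (_ *: _); transitivity (- (4 * ('i * 'i)) : R[i]); first by ring.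
  by rewrite mulCii; ring.
have c4 : (4 : R[i]) = (4 : R)%:C%C by rewrite rmorph_nat.
rewrite XX; split=> -[k kE].
  exists (4^-1 * k); rewrite rmorphM fmorphV /= -c4 -scale_scalar_mx -kE.
  by rewrite scalerA mulVf ?scale1r // c4 realC_eq0 pnatr_eq0.
by exists (4 * k); rewrite kE scale_scalar_mx c4 -(rmorphM (real_complex R)).
Qed.

Lemma normal_gram : scalar3 ->
  ((C - D ^t*) *m D \is normalmx) <-> comm_mx P1 P2.
Proof.
move=> /gram22_scalar[k GG].
have XE : C - D ^t* = (2 * 'i) *: im_part C D.
  by rewrite /im_part scalerA mulfV ?scale1r // twoCi_neq0.
rewrite XE {2}(lower_re_im_part C D).
exact: normal_iff_gram_commute GG.
Qed.

(** [P3] is scalar, so its determinant is the square of [pauli0 P3], which is nonnegative. *)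
Lemma det_im_gram : scalar3 -> sqrtC (\det (im_mx B)) = (pauli0 P3)%:C%C.
Proof.
move=> [u1 u2 u3]; rewrite det_im_mx_block det_mx2 -/P3.
have [-> -> -> ->] := hermitian_pauli (gram22_adjoint alpha C D).
have z : Complex 0 0 = 0 :> R[i] by [].
rewrite -/P3 u1 u2 u3 oppr0 z mulr0 !subr0 addr0 -expr2 sqrCK // ler0c.
have h (x y t : R) : 0 <= qform x y t 0 1 -> 0 <= t by rewrite /qform; lra.
exact: h (gram_qform_ge0 alpha C D 0 1).
Qed.

(** [B *m B] is block diagonal. By [eigenvalue_swap] the second block of its imaginary part adds no
    eigenvalue to those of [2 *: P2]. *)
Lemma eigenvalue_im_square (s : R[i]) : scalar3 ->
  eigenvalue (im_mx (B *m B)) s <->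
  (s - (2 * pauli0 P2)%:C%C) ^+ 2 = (4 * pauli_dot P2 P2)%:C%C.
Proof.
move=> sc3; have [k GG] := (proj1 gram22_scalar) sc3.
have BB : B *m B = block_mx ((alpha ^+ 2)%:M + C *m D) 0 0 ((alpha ^+ 2)%:M
  + D *m C).
  rewrite /B mulmx_block -!scalar_mxM mulrNN -expr2 [D *m C + _]addrC.
  by rewrite !mul_scalar_mx !mul_mx_scalar !scaleNr addrN addrC subrr.
have [_ swapE] := parts_swap C D; have [swapL _] := parts_swap C D.
have imB : im_mx (B *m B) = block_mx (2 *: P2) 0 0 (2 *: gram12 alpha D C).
  by rewrite BB im_mx_block_diag (im_gram_product alpha C D) (im_gram_product
    alpha D C).
have swap : eigenvalue (2 *: gram12 alpha D C) s -> eigenvalue (2 *: P2) s.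
  rewrite /P2 /gram12 swapL swapE; exact: eigenvalue_swap GG.
rewrite imB eigenvalue_block_diag.
rewrite -(eigenvalue_hermitian s (gram12_adjoint alpha C D)).
split=> [[h|h]|h]; [exact: h|exact: (swap h)|left; exact: h].
Qed.

End Conditions.

(** * The algebra of condition (ii) *)

Lemma biquadratic_factor (F : fieldType) (S T s1 s2 : F) :
  'X^4 - S%:P * 'X^2 + T%:P =
    ('X - s1%:P) * ('X - (- s1)%:P) * (('X - s2%:P) * ('X - (- s2)%:P)) <->
  S = s1 ^+ 2 + s2 ^+ 2 /\ T = s1 ^+ 2 * s2 ^+ 2.
Proof.
have hE := (@hornerD F, @hornerN F, @hornerM F, @hornerC F, @hornerX F,
  @hornerXn F).
split=> [e|[-> ->]].
  have := congr1 (fun p => p.[0]) e; rewrite /= !hE => e0.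
  have := congr1 (fun p => p.[1]) e; rewrite /= !hE => e1.
  have TE : T = s1 ^+ 2 * s2 ^+ 2.
    by transitivity (0 ^+ 4 - S * 0 ^+ 2 + T); [ring|rewrite e0; ring].
  split => //; transitivity (1 + T - (1 ^+ 4 - S * 1 ^+ 2 + T)); first by ring.
  by rewrite e1 TE; ring.
by rewrite !(polyCD, polyCN, polyCM, polyC_exp); ring.
Qed.

(** A matrix with complex Pauli coordinates (p, u) has trace 2 p and determinant p^2 - u.u. By
    [gram_product] the coordinates of [T] are p1 - p3 + 2 i p2 and u1 + 2 i u2, since u3 = 0. *)
Lemma gram_trace_det (R : realType) (alpha : R[i]) (C D : 'M[R[i]]_2) :
  let P1 := gram11 alpha C D in
  let P2 := gram12 alpha C D in
  let P3 := gram22 alpha C D in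
  let T := (alpha ^+ 2)%:M + C *m D in
  [/\ pauli1 P3 = 0, pauli2 P3 = 0 & pauli3 P3 = 0] ->
  T 0 0 + T 1 1 = Complex (2 * (pauli0 P1 - pauli0 P3)) (4 * pauli0 P2) /\
  \det T = Complex ((pauli0 P1 - pauli0 P3) ^+ 2 - 4 * pauli0 P2 ^+ 2
                      - pauli_dot P1 P1 + 4 * pauli_dot P2 P2)
                   (4 * ((pauli0 P1 - pauli0 P3) * pauli0 P2)
                     - 4 * pauli_dot P1 P2).
Proof.
move=> P1 P2 P3 T [u1 u2 u3].
have TE : T = P1 - P3 + (2 * 'i) *: P2 by exact: gram_product.
have : P1 ^t* = P1 by exact: gram11_adjoint.
have : P2 ^t* = P2 by exact: gram12_adjoint.
have : P3 ^t* = P3 by exact: gram22_adjoint.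
rewrite det_mx2 TE; clearbody P1 P2 P3; rewrite !mxE {T TE}.
move=> /hermitian_pauli[-> -> -> ->] /hermitian_pauli[-> -> -> ->].
move=> /hermitian_pauli[-> -> -> ->]; rewrite u1 u2 u3 /pauli_dot.
move: (pauli0 P1) (pauli1 P1) (pauli2 P1) (pauli3 P1) => p x y z.
move: (pauli0 P2) (pauli1 P2) (pauli2 P2) (pauli3 P2) => q u v w.
move: (pauli0 P3) => k {u1 u2 u3 P1 P2 P3}.
have -> : 2 * 'i = Complex 0 2 :> R[i].
  by apply/eqP; rewrite eq_complex /=; apply/andP; split; apply/eqP; ring.
by split; apply/eqP; rewrite eq_complex /=; apply/andP; split; apply/eqP; ring.
Qed.

(** Lagrange's identity: the defect in Cauchy-Schwarz is the squared length of the cross product. *)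
Lemma pauli_cross_eq0 (R : realType) (x y z u v w : R) :
  (x * u + y * v + z * w) ^+ 2 =
    (x * x + y * y + z * z) * (u * u + v * v + w * w) <->
  [/\ x * v = y * u, y * w = z * v & x * w = z * u].
Proof.
have lagrange : (x * x + y * y + z * z) * (u * u + v * v + w * w)
    - (x * u + y * v + z * w) ^+ 2
    = (x * v - y * u) ^+ 2 + (y * w - z * v) ^+ 2 + (x * w - z * u) ^+ 2
      by ring.
split=> [e|[e1 e2 e3]].
  move: lagrange; rewrite e subrr => /esym/eqP.
  rewrite paddr_eq0 ?addr_ge0 ?sqr_ge0 // paddr_eq0 ?sqr_ge0 // !expf_eq0 /=.
  by move=> /andP[/andP[h1 h2] h3]; split; apply/eqP; rewrite -subr_eq0.
by move: lagrange; rewrite e1 e2 e3 !subrr expr0n !addr0 => /eqP;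
  rewrite subr_eq0 => /eqP.
Qed.

Lemma pauli_dot_cauchy (R : realType) (M N : 'M[R[i]]_2) :
  pauli_dot M N ^+ 2 <= pauli_dot M M * pauli_dot N N.
Proof.
rewrite /pauli_dot -subr_ge0.
move: (pauli1 M) (pauli2 M) (pauli3 M) (pauli1 N) (pauli2 N) (pauli3 N)
  => x y z u v w.
rewrite [X in 0 <= X](_ : _ =
  (x * v - y * u) ^+ 2 + (y * w - z * v) ^+ 2 + (x * w - z * u) ^+ 2);
    last by ring.
by rewrite !addr_ge0 ?sqr_ge0.
Qed.

Section SpectralAlgebra.
Context (R : realType) (p1 p2 p3 d11 d12 d22 : R).
Let tr2 : R[i] := Complex (2 * (p1 - p3)) (4 * p2).
Let det2 : R[i] := Complex ((p1 - p3) ^+ 2 - 4 * p2 ^+ 2 - d11 + 4 * d22)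
                           (4 * ((p1 - p3) * p2) - 4 * d12).
Let radius_condition (r : R) :=
  [/\ posdef (p1 - r ^+ 2) p2 p3, d22 = r ^+ 2 * p3,
      d12 = 2 * r ^+ 2 * p2 & d11 = 4 * r ^+ 2 * (p1 - r ^+ 2)].
Let spectral_condition (g1 g2 s1 s2 : R[i]) :=
  [/\ tr2 = g1 ^+ 2 + g2 ^+ 2 /\ det2 = g1 ^+ 2 * g2 ^+ 2, s1 <> s2,
      forall s, (s - (2 * p2)%:C%C) ^+ 2 = (4 * d22)%:C%C <-> s = s1 \/ s = s2
    & 4 * p3%:C%C * (g1 + g2) ^+ 2 = (s1 - s2) ^+ 2].

Let c4 : (4 : R[i]) = (4 : R)%:C%C. Proof. by rewrite rmorph_nat. Qed.

(* n = (g1 + g2)^2 satisfies (n - tr2)^2 = 4 det2, and n = 4 d22 / p3. *)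
Lemma radius_of_spectral (g1 g2 s1 s2 : R[i]) :
  0 <= p3 -> 0 <= d22 -> d12 ^+ 2 < d11 * d22 ->
  spectral_condition g1 g2 s1 s2 -> exists2 r, 0 < r & radius_condition r.
Proof.
move=> p30 d20 dd [[trE detE] s12 sE e].
have /eqP s12' : s1 - s2 != 0 by rewrite subr_eq0; apply/eqP.
have h1 : (s1 - (2 * p2)%:C%C) ^+ 2 = (4 * d22)%:C%C by apply/sE; left.
have h2 : (s2 - (2 * p2)%:C%C) ^+ 2 = (4 * d22)%:C%C by apply/sE; right.
have sum : s1 + s2 = 2 * (2 * p2)%:C%C.
  have : (s1 - s2) * (s1 + s2 - 2 * (2 * p2)%:C%C) = 0.
    transitivity ((s1 - (2 * p2)%:C%C) ^+ 2 - (s2 - (2 * p2)%:C%C) ^+ 2);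
      first by ring.
    by rewrite h1 h2 subrr.
  by move/eqP; rewrite mulf_eq0 => /orP[/eqP //|]; rewrite subr_eq0 => /eqP.
have sq : (s1 - s2) ^+ 2 = 4 * (4 * d22)%:C%C.
  rewrite -h1; transitivity ((2 * s1 - (s1 + s2)) ^+ 2); first by ring.
  by rewrite sum; ring.
have sq0 : (s1 - s2) ^+ 2 != 0 by rewrite expf_neq0 //; apply/eqP.
have d2n : d22 != 0.
  by apply: contraNneq sq0 => d0; rewrite sq d0 mulr0 rmorph0 mulr0.
have p3n : p3 != 0.
  by apply: contraNneq sq0 => p0; rewrite -e p0 rmorph0 mulr0 mul0r.
have pc : (p3%:C%C : R[i]) != 0 by rewrite realC_eq0.
have p3p : 0 < p3 by rewrite lt0r p3n.
have d2p : 0 < d22 by rewrite lt0r d2n.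
(* [rho] is the future [r ^+ 2]. *)
pose rho := d22 / p3; have rho0 : 0 < rho by rewrite divr_gt0.
have nE : (g1 + g2) ^+ 2 = (4 * rho)%:C%C.
  apply: (@mulfI _ (4 * p3%:C%C)).
    by rewrite mulf_neq0 // pnatr_eq0.
  by rewrite e sq -mulrA -rmorphM; congr (_ * _%:C%C); rewrite /rho; field.
have : ((g1 + g2) ^+ 2 - tr2) ^+ 2 = 4 * det2 by rewrite trE detE; ring.
rewrite nE expr2 c4 => /eqP; rewrite eq_complex /= => /andP[/eqP re /eqP im].
have d22E : d22 = rho * p3 by rewrite /rho divfK.
(* The imaginary part of the equation determines [d12], the real part [d11]. *)
have d12E : d12 = 2 * rho * p2 by lra.
have d11E : d11 = 4 * rho * (p1 - rho) by lra.
have r2 : Num.sqrt rho ^+ 2 = rho by rewrite sqr_sqrtr // ltW.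
exists (Num.sqrt rho); first by rewrite sqrtr_gt0.
rewrite /radius_condition r2; split => //.
(* The strict inequality [dd], which encodes non-normality, turns into positive definiteness. *)
have lt : p2 ^+ 2 < (p1 - rho) * p3.
  rewrite -(@ltr_pM2l _ (4 * rho ^+ 2)); last by rewrite mulr_gt0 // exprn_gt0.
  move: dd; rewrite d12E d11E d22E; lra.
split => //; rewrite -(@pmulr_lgt0 _ p3) //.
exact: le_lt_trans (sqr_ge0 _) lt.
Qed.

(** The roots [r + z] and [r - z] have sum [2 * r]. With [z ^+ 2 = r ^+ 2 - w] their product is [w],
    and w = 2 r^2 - tr2 / 2 makes the sum of their squares [tr2]. The eigenvalues differ by
    [4 * (r * q)], where [q] is the square root of [p3]. *)
Lemma spectral_of_radius (r : R) : 0 < r -> radius_condition r ->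
  d12 ^+ 2 < d11 * d22 /\ exists g1 g2 s1 s2, spectral_condition g1 g2 s1 s2.
Proof.
move=> r0 [[_ p3p lt] d22E d12E d11E]; split.
  rewrite d12E d11E d22E.
  have -> : (2 * r ^+ 2 * p2) ^+ 2 = 4 * r ^+ 4 * p2 ^+ 2 by ring.
  have -> : 4 * r ^+ 2 * (p1 - r ^+ 2) * (r ^+ 2 * p3) =
    4 * r ^+ 4 * ((p1 - r ^+ 2) * p3) by ring.
  by rewrite ltr_pM2l // mulr_gt0 // exprn_gt0.
pose w : R[i] := Complex (2 * r ^+ 2 - (p1 - p3)) (- (2 * p2)).
pose z := sqrtc ((r ^+ 2)%:C%C - w).
have z2 : z ^+ 2 = (r ^+ 2)%:C%C - w by rewrite /z sqr_sqrtc.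
pose q := Num.sqrt p3; have q2 : q ^+ 2 = p3 by rewrite sqr_sqrtr // ltW.
have q0 : 0 < q by rewrite sqrtr_gt0.
exists (r%:C%C + z), (r%:C%C - z), (2 * p2 + 2 * r * q)%:C%C, (2 * p2
  - 2 * r * q)%:C%C.
have rc : ((r ^+ 2)%:C%C : R[i]) = r%:C%C ^+ 2 by rewrite rmorphXn.
split.
- split.
    transitivity (2 * r%:C%C ^+ 2 + 2 * z ^+ 2); last by ring.
    rewrite z2 -rc; have -> : (2 : R[i]) = (2 : R)%:C%C by rewrite rmorph_nat.
    by apply/eqP; rewrite eq_complex /=; apply/andP; split; apply/eqP; ring.
  transitivity ((r%:C%C ^+ 2 - z ^+ 2) ^+ 2); last by ring.
  rewrite z2 -rc opprB addrC subrK expr2.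
  by apply/eqP; rewrite eq_complex /= d11E d12E d22E; apply/andP; split;
    apply/eqP; ring.
- move=> /complexI h; have : 0 < r * q by rewrite mulr_gt0.
  lra.
- move=> s; have -> : (4 * d22)%:C%C = ((2 * r * q)%:C%C) ^+ 2 :> R[i].
    by rewrite -rmorphXn; congr _%:C%C; rewrite d22E -q2; ring.
  rewrite rmorphD rmorphB /=; set c := (2 * p2)%:C%C; set d := (2 * r * q)%:C%C.
  split=> [/eqP|[|] ->]; last 2 first.
  + by rewrite addrC addKr.
  + by rewrite addrC addKr sqrrN.
  rewrite eqf_sqr => /orP[] /eqP h; [left|right].
    by rewrite -h addrC subrK.
  by rewrite -h addrC subrK.
- have -> : r%:C%C + z + (r%:C%C - z) = 2 * r%:C%C by ring.
  rewrite -rmorphB -q2 rmorphXn /=.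
  have -> : 2 * p2 + 2 * r * q - (2 * p2 - 2 * r * q) = 4 * (r * q) by ring.
  by rewrite !rmorphM /= -c4; ring.
Qed.

End SpectralAlgebra.

(** Conditions (i) and (ii) at angle 0. Non-normality means strictness in Cauchy-Schwarz for the
    Pauli vectors of [P1] and [P2]; condition (ii) is translated by the formulas for trace,
    determinant and eigenvalues. *)
Lemma gram_condition_iff (R : realType) (alpha : R[i]) (C D : 'M[R[i]]_2) :
  let B : 'M[R[i]]_(2 + 2) := block_mx alpha%:M C D (- alpha)%:M in
  let X := C - D ^t* in
  ((scalar_multiple_of_unitary X /\ X *m D \isn't normalmx) /\
   (exists sigma1 sigma2 s1 s2 : R[i],
      [/\ char_poly B = ('X - sigma1%:P) * ('X - (- sigma1)%:P)
                        * (('X - sigma2%:P) * ('X - (- sigma2)%:P)),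
          s1 <> s2,
          forall s : R[i],
            eigenvalue (im_mx (B *m B)) s <-> s = s1 \/ s = s2
        & 4 * sqrtC (\det (im_mx B)) * (sigma1 + sigma2) ^+ 2
          = (s1 - s2) ^+ 2])) <->
  exists2 r : R, 0 < r &
    gram_condition (gram11 alpha C D) (gram12 alpha C D) (gram22 alpha C D) r.
Proof.
move=> B X; set P1 := gram11 alpha C D; set P2 := gram12 alpha C D.
set P3 := gram22 alpha C D.
have hP1 : P1 ^t* = P1 by exact: gram11_adjoint.
have hP2 : P2 ^t* = P2 by exact: gram12_adjoint.
have char (sc3 : [/\ pauli1 P3 = 0, pauli2 P3 = 0 & pauli3 P3 =
  0]) sigma1 sigma2 :
    char_poly B = ('X - sigma1%:P) * ('X - (- sigma1)%:P)
                        * (('X - sigma2%:P) * ('X - (- sigma2)%:P)) <->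
    Complex (2 * (pauli0 P1 - pauli0 P3)) (4 * pauli0 P2) =
      sigma1 ^+ 2 + sigma2 ^+ 2 /\
    Complex ((pauli0 P1 - pauli0 P3) ^+ 2 - 4 * pauli0 P2 ^+ 2
                      - pauli_dot P1 P1 + 4 * pauli_dot P2 P2)
                   (4 * ((pauli0 P1 - pauli0 P3) * pauli0 P2)
                     - 4 * pauli_dot P1 P2)
     = sigma1 ^+ 2 * sigma2 ^+ 2.
  have [h1 h2] := gram_trace_det sc3.
  by rewrite -h1 -h2 -biquadratic_factor /B char_poly_block.
have p30 : 0 <= pauli0 P3.
  have h (x y t : R) : 0 <= qform x y t 0 1 -> 0 <= t by rewrite /qform; lra.
  exact: h (gram_qform_ge0 alpha C D 0 1).
have comm : comm_mx P1 P2 <->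
    pauli_dot P1 P2 ^+ 2 = pauli_dot P1 P1 * pauli_dot P2 P2.
  by rewrite /comm_mx (pauli_commute hP1 hP2) -pauli_cross_eq0.
have det sc3 := @det_im_gram R alpha C D sc3.
have eig s sc3 := @eigenvalue_im_square R alpha C D s sc3.
have uni := @unitary_gram22 R alpha C D.
have nor sc3 := @normal_gram R alpha C D sc3.
rewrite -/B -/P1 -/P2 -/P3 -/X in det eig uni nor.
have d20 : 0 <= pauli_dot P2 P2 by rewrite /pauli_dot !addr_ge0 //
  -expr2 sqr_ge0.
clearbody P1 P2 P3 B X.
have dotC := pauli_dot_cauchy P1 P2.
split.
  move=> [[/uni sc3 nX] [sg1 [sg2 [s1 [s2 [/(char sc3) S12 s12 ev e]]]]]].
  have lt : pauli_dot P1 P2 ^+ 2 < pauli_dot P1 P1 * pauli_dot P2 P2.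
    rewrite lt_neqAle dotC andbT; apply/eqP => /comm/(nor sc3).
    by rewrite (negbTE nX).
  rewrite (det sc3) in e.
  have [|r r0 [pd e22 e12 e11]] := @radius_of_spectral R (pauli0 P1)
    (pauli0 P2) (pauli0 P3)
    _ _ _ sg1 sg2 s1 s2 p30 d20 lt.
    by split => // s; rewrite -(eig s sc3).
  by exists r.
move=> [r r0 [sc3 rc]].
have [lt [g1 [g2 [s1 [s2 [S12 s12 ev e]]]]]] := spectral_of_radius r0 rc.
split.
  split; first exact/uni.
  apply/negP => /(nor sc3)/comm h; by rewrite h ltxx in lt.
exists g1, g2, s1, s2; split => //; first exact/(char sc3).
  by move=> s; rewrite (eig s sc3).
by rewrite (det sc3).
Qed.

(** * Rotations *)

Lemma cis_neq0 (R : realType) (t : R) : cis t != 0.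
Proof.
apply/eqP => /eqP; rewrite eq_complex /= => /andP[/eqP c0 /eqP s0].
by have := cos2Dsin2 t; rewrite c0 s0 expr0n /= addr0 => /eqP;
  rewrite eq_sym oner_eq0.
Qed.

Lemma cisNK (R : realType) (t : R) : cis (- t) * cis t = 1.
Proof.
apply/eqP; rewrite eq_complex /= cosN sinN; have := cos2Dsin2 t => h.
by apply/andP; split; apply/eqP; [rewrite -h|]; ring.
Qed.

Lemma conj_cisN (R : realType) (t : R) : Num.conj (cis (- t)) = cis t.
Proof. by apply/eqP; rewrite eq_complex /= cosN sinN opprK !eqxx. Qed.

Lemma norm_cis (R : realType) (t : R) : `|cis t| = 1.
Proof. by rewrite normc_def /= cos2Dsin2 sqrtr1. Qed.

Lemma polar_form (R : realType) (z : R[i]) : z != 0 ->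
  exists t r : R, 0 < r /\ z = r%:C%C * cis t.
Proof.
case: z => x y; rewrite eq_complex /= => xy0.
have n0 : 0 < x ^+ 2 + y ^+ 2.
  rewrite lt0r addr_ge0 ?sqr_ge0 // andbT paddr_eq0 ?sqr_ge0 //.
  by rewrite !expf_eq0.
set r := Num.sqrt (x ^+ 2 + y ^+ 2); have r0 : 0 < r by rewrite sqrtr_gt0.
have r2 : r ^+ 2 = x ^+ 2 + y ^+ 2 by rewrite sqr_sqrtr // ltW.
have rn0 : r != 0 by rewrite gt_eqF.
have xr : - 1 <= x / r <= 1.
  rewrite -ler_norml normrM normfV (gtr0_norm r0) ler_pdivrMr // mul1r.
  rewrite -sqrtr_sqr ler_wsqrtr // lerDl sqr_ge0 //.
have cosE := acosK xr.
have sinE : sin (acos (x / r)) = `|y| / r.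
  rewrite sin_acos //; have -> : 1 - (x / r) ^+ 2 = (y / r) ^+ 2.
    by rewrite !expr_div_n r2; field; rewrite gt_eqF.
  by rewrite sqrtr_sqr normrM normfV (gtr0_norm r0).
(* [acos] sees only the absolute value of [y]; the lower half plane needs the opposite angle. *)
have [y0|y0] := lerP 0 y.
  exists (acos (x / r)), r; split=> //; apply/eqP; rewrite eq_complex /=.
  rewrite cosE sinE ger0_norm // !mul0r subr0 addr0.
  by apply/andP; split; apply/eqP; field.
exists (- acos (x / r)), r; split=> //; apply/eqP; rewrite eq_complex /=.
rewrite cosN sinN cosE sinE ltr0_norm // !mul0r subr0 addr0.
by apply/andP; split; apply/eqP; field.
Qed.

(** For nonzero [u] this is the image under multiplication by [u]; written as a preimage, it
    commutes with unions by computation. *)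
Definition rotate (R : realType) (u : R[i]) (S : set R[i]) : set R[i] :=
  [set z | S (u^-1 * z)].

Section Rotation.
Context (R : realType) (u : R[i]) (u1 : `|u| = 1).
Implicit Types (S T E W : set R[i]).

Let u0 : u != 0. Proof. by rewrite -normr_eq0 u1 oner_eq0. Qed.

Lemma rotateK S : rotate u^-1 (rotate u S) = S.
Proof. by apply/seteqP; split => z; rewrite /rotate /= invrK mulKf. Qed.

Lemma rotate_cvx S : cvx S -> cvx (rotate u S).
Proof.
move=> cS x y k k01 Sx Sy; rewrite /rotate /= mulrDr !(mulrCA u^-1).
exact: cS.
Qed.

Lemma rotate_setU S T : rotate u (S `|` T) = rotate u S `|` rotate u T.
Proof. by []. Qed.

End Rotation.

(** One inclusion holds for every nonzero factor; the other is the same inclusion for [u^-1]. *)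
Lemma rotate_hull (R : realType) (u : R[i]) (S : set R[i]) : `|u| = 1 ->
  convex_hull (rotate u S) = rotate u (convex_hull S).
Proof.
move=> u1; have u0 : u != 0 by rewrite -normr_eq0 u1 oner_eq0.
have sub (v : R[i]) (T : set R[i]) : v != 0 ->
    convex_hull (rotate v T) `<=` rotate v (convex_hull T).
  move=> v0; apply: convex_hull_min.
    by apply: rotate_cvx; exact: convex_hull_cvx.
  by move=> z Tz; apply: (@sub_convex_hull _ T (v^-1 * z)); exact: Tz.
apply/seteqP; split; first exact: (sub u S u0).
move=> z; rewrite /rotate /=.
have := @sub u^-1 (rotate u S); rewrite invr_eq0 rotateK // => /(_ u0) h.
by move=> /h; rewrite /rotate /= invrK mulVKf.
Qed.

Lemma rotate_ellipse (R : realType) (u c : R[i]) (E : set R[i]) : `|u| = 1 ->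
  is_ellipse E c -> is_ellipse (rotate u E) (u * c).
Proof.
move=> u1 [f1 [f2 [a [lt -> ->]]]].
have u0 : u != 0 by rewrite -normr_eq0 u1 oner_eq0.
have norm z f : `|z - u * f| = `|u^-1 * z - f|.
  by rewrite -[RHS]mul1r -u1 -normrM mulrBr mulVKf.
exists (u * f1), (u * f2), a; split.
- by rewrite -mulrBr normrM u1 mul1r.
- by apply/seteqP; split => z; rewrite /rotate /= !norm.
- by rewrite -mulrDr mulrA.
Qed.

Lemma rotate_not_sub (R : realType) (u : R[i]) (E F : set R[i]) : `|u| = 1 ->
  ~ E `<=` convex_hull F -> ~ rotate u E `<=` convex_hull (rotate u F).
Proof.
move=> u1 nsub sub; apply: nsub => z Ez; move: sub; rewrite rotate_hull //.
have u0 : u != 0 by rewrite -normr_eq0 u1 oner_eq0.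
by move=> /(_ (u * z)); rewrite /rotate /= mulKf // => /(_ Ez).
Qed.

Lemma rotate_bi_elliptical (R : realType) (u : R[i]) (W : set R[i]) :
  `|u| = 1 ->
  bi_elliptical W -> bi_elliptical (rotate u W).
Proof.
move=> u1 [E1 [E2 [c1 [c2 [[e1 e2 c12] [n1 n2 ->]]]]]].
have u0 : u != 0 by rewrite -normr_eq0 u1 oner_eq0.
exists (rotate u E1), (rotate u E2), (u * c1), (u * c2); split; split.
- exact: rotate_ellipse.
- exact: rotate_ellipse.
- by move=> /(mulfI u0).
- exact: rotate_not_sub.
- exact: rotate_not_sub.
- by rewrite -rotate_setU rotate_hull.
Qed.

Lemma rotate_numerical_range (R : realType) (n : nat) (u : R[i])
    (A : 'M[R[i]]_n) :
  u != 0 -> numerical_range (u *: A) = rotate u (numerical_range A).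
Proof.
move=> u0; apply/seteqP; split => z [x x1 zE]; exists x => //.
  by rewrite zE -scalemxAl -scalemxAr mxE mulKf.
by rewrite -scalemxAl -scalemxAr mxE -zE mulVKf.
Qed.

Lemma normalmx_scale (R : realType) (n : nat) (c : R[i]) (M : 'M[R[i]]_n) :
  c != 0 -> (c *: M \is normalmx) = (M \is normalmx).
Proof.
move=> c0; have cc0 : c * Num.conj c != 0 by rewrite mulf_neq0 ?conjC_eq0.
apply/normalmxP/normalmxP; rewrite linearZ /= map_mxZ -!scalemxAl
  -!scalemxAr !scalerA.
  by rewrite [Num.conj c * c]mulrC => /(scalerI cc0).
by move=> ->; rewrite mulrC.
Qed.

Theorem theorem5 (R : realType) (alpha : R[i]) (C D : 'M[R[i]]_2) :
  let A : 'M[R[i]]_(2 + 2) := block_mx alpha%:M C D (- alpha)%:M in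
  bi_elliptical (numerical_range A) <->
  exists theta : R,
    let B := cis (- theta) *: A in
    let X := cis (- theta) *: C - cis theta *: D ^t* in
    (scalar_multiple_of_unitary X /\ X *m D \isn't normalmx) /\
    (exists sigma1 sigma2 s1 s2 : R[i],
      [/\ char_poly B = ('X - sigma1%:P) * ('X - (- sigma1)%:P)
                        * (('X - sigma2%:P) * ('X - (- sigma2)%:P)),
          s1 <> s2,
          forall s : R[i],
            eigenvalue (im_mx (B *m B)) s <-> s = s1 \/ s = s2
        & 4 * sqrtC (\det (im_mx B)) * (sigma1 + sigma2) ^+ 2
          = (s1 - s2) ^+ 2]).
Proof.
move=> A; cbv zeta.
have BE t : cis (- t) *: A = block_mx (cis (- t) * alpha)%:M (cis (- t) *: C)
    (cis (- t) *: D) (- (cis (- t) * alpha))%:M.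
  by rewrite /A scale_block_mx !scale_scalar_mx mulrN.
have XE t : cis (- t) *: C - cis t *: D ^t* = cis (- t) *: C - (cis (- t) *:
  D) ^t*.
  have -> // : (cis (- t) *: D) ^t* = cis t *: D ^t*.
  by apply/matrixP => i j; rewrite !mxE (rmorphM Num.conj) /= conj_cisN.
(* The product in condition (i) contains [D] itself; the rotated block differs from it by a nonzero
   scalar, which preserves normality. *)
have nE t (X : 'M[R[i]]_2) :
    (X *m D \is normalmx) = (X *m (cis (- t) *: D) \is normalmx).
  by rewrite -scalemxAr normalmx_scale // cis_neq0.
have cond t := gram_condition_iff (cis (- t) * alpha) (cis (- t) *:
  C) (cis (- t) *: D).
split=> [bi|[t]].
  (* Distinct centers are not both 0; the ellipses are exchanged if necessary. *)
  have [E1 [E2 [c1 [c2 [e1 [e2 [c10 [nsub WE]]]]]]]] : exists E1 E2 c1 c2,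
      is_ellipse E1 c1 /\ is_ellipse E2 c2 /\ c1 != 0 /\
      ~ E1 `<=` convex_hull E2 /\ numerical_range A = convex_hull (E1 `|` E2).
    case: bi => [E1 [E2 [c1 [c2 [[e1 e2 c12] [n1 n2 WE]]]]]].
    have [c10|c10] := eqVneq c1 0; last by exists E1, E2, c1, c2.
    exists E2, E1, c2, c1; rewrite setUC; do !split => //.
    by apply/eqP => c20; apply: c12; rewrite c10 c20.
  (* The angle is the argument of the nonzero center, so that the rotation moves this center to the
     positive real [r]. *)
  have [t [r [r0 c1E]]] := polar_form c10.
  exists t; rewrite BE XE (nE t); apply/(cond t); exists r => //.
  have u1 := norm_cis (- t).
  have [a1 [b1 [d1 [pd1 E1E]]]] := proj1 (is_ellipse_ell _ _) (rotate_ellipse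
    u1 e1).
  have [a2 [b2 [d2 [pd2 E2E]]]] := proj1 (is_ellipse_ell _ _) (rotate_ellipse
    u1 e2).
  rewrite c1E mulrCA cisNK mulr1 in E1E.
  apply: (gram_necessary pd1 pd2 r0 E1E E2E); first exact: rotate_not_sub.
  by rewrite -BE rotate_numerical_range ?cis_neq0 // WE
    -rotate_setU rotate_hull.
rewrite BE XE (nE t) => /(cond t)[r r0 /(gram_sufficient r0)].
rewrite -BE rotate_numerical_range ?cis_neq0 // => bi.
(* The inverse phase rotates the range back to that of [A]. *)
have u1 : `|(cis (- t))^-1| = 1 by rewrite normfV norm_cis invr1.
by have := rotate_bi_elliptical u1 bi; rewrite rotateK // norm_cis.
Qed.
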